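(* Let $M=(\ell_\infty\setminus c_0)\cup\{0\}$, regarded as a subset of $\ell_\infty$, and let $\mathfrak{c}=2^{\aleph_0}$. Then: (1) $M$ is $(d,1)$-genalgebrable and $(d,1)$-$C^*$-genalgebrable for every $d\in\mathbb{N}$. (2) If $d,n<\infty$ and $n\neq 1$, then $M$ is neither $(d,n)$-genalgebrable nor $(d,n)$-$C^*$-genalgebrable. (3) $M$ is $(\mathfrak{c},\kappa)$-$C^*$-genalgebrable for every cardinal $1\le\kappa\le\mathfrak{c}$. (4) $M$ is $(\aleph_0,\kappa)$-genalgebrable for every cardinal $1\le\kappa\le\aleph_0$. (5) $M$ is $(\kappa,\kappa)$-genalgebrable for every cardinal $\aleph_0<\kappa\le\mathfrak{c}$.
   Context: $\ell_\infty$ is the $C^*$-algebra of bounded complex sequences, $c_0$ its ideal of null sequences, $\mathbb{N}=\{1,2,\dots\}$; $\dim$ is the algebraic (Hamel) dimension over $\mathbb{C}$. For a nonempty subset $S$ of an algebra, $A(S)$ denotes the linear span of all finite products $s_1\cdots s_n$ ($n\ge1$, $s_i\in S$). $S$ generates an algebra $B$ as an algebra if $S\subseteq B$ and $A(S)=B$. A nonempty set $S\subseteq B_{sa}=\{b\in B:b=b^*\}$ generates a $C^*$-algebra $B$ as a $C^*$-algebra if $\overline{A(S)}=B$. Convention: for $C^*$-algebras and for self-adjoint ($*$-closed) subalgebras of $C^*$-algebras only generating sets consisting of self-adjoint elements are considered. $\mathrm{gen}(B)$ (respectively $\mathrm{gen}_{C^*}(B)$) is the least cardinality of a set generating $B$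 as an algebra (respectively, as a $C^*$-algebra). Let $d,\kappa$ be cardinals. A subset $M$ of a Banach algebra $A$ is $(d,\kappa)$-genalgebrable if there is a subalgebra $B$ of $A$ (not necessarily closed) with $B\subseteq M\cup\{0\}$, $\dim(B)=d$ and $\mathrm{gen}(B)=\kappa$. A subset $M$ of a $C^*$-algebra $A$ is $(d,\kappa)$-$C^*$-genalgebrable if there is a $C^*$-subalgebra $B$ of $A$ with $B\subseteq M\cup\{0\}$, $\dim(B)=d$ and $\mathrm{gen}_{C^*}(B)=\kappa$. *)

(* Defs.v *)
From HB Require Import structures.
From mathcomp Require Import all_boot all_order all_algebra.
From mathcomp Require Import all_classical all_reals all_analysis.
From mathcomp Require Import complex.

Set Implicit Arguments.
Unset Strict Implicit.
Unset Printing Implicit Defensive.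

Import Order.TTheory GRing.Theory Num.Theory numFieldNormedType.Exports.
Import ComplexField.Normc.

Local Open Scope classical_set_scope.
Local Open Scope ring_scope.
Local Open Scope complex_scope.
Local Open Scope card_scope.

(* A cardinal is represented by any set having it; two such sets are compared
   with #= and #<=, as in mathcomp.classical.cardinality. *)

Definition least_card (T U : Type) (P : set (set T)) (K : set U) : Prop :=
  (exists2 S, P S & S #= K) /\ (forall S, P S -> K #<= S).

Section LinearAlgebra.
Context {K : fieldType} {V : lmodType K}.
Implicit Types B E : set V.

Definition linspan E : set V :=
  [set x | exists (n : nat) (a : 'I_n -> K) (e : 'I_n -> V),
     (forall i, E (e i)) /\ x = \sum_(i < n) a i *: e i].

Definition lin_indep E : Prop :=
  forall (n : nat) (a : 'I_n -> K) (e : 'I_n -> V),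
    injective e -> (forall i, E (e i)) ->
    \sum_(i < n) a i *: e i = 0 -> forall i, a i = 0.

Definition hamel_basis B E : Prop := lin_indep E /\ linspan E = B.

Definition has_dim (U : Type) B (D : set U) : Prop :=
  exists2 E, hamel_basis B E & E #= D.

End LinearAlgebra.

Section Algebras.
Context {K : fieldType} {A : algType K}.
Implicit Types B S : set A.

(* The empty product is excluded, and subalgebras need not contain 1. *)
Definition products S : set A :=
  [set x | exists2 s : seq A,
     s != [::] /\ (forall y, y \in s -> S y) & x = \prod_(y <- s) y].

Definition algspan S : set A := linspan (products S).

Definition subalgebra B : Prop :=
  [/\ B 0,
      (forall x y, B x -> B y -> B (x + y)),
      (forall a x, B x -> B (a *: x)) &
      (forall x y, B x -> B y -> B (x * y))].

End Algebras.

(* Sequences are indexed from 0 instead of 1. *)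

Section Linf.
Variable R : realType.
Local Notation normc := (@normc R).

Definition bounded_seq : {pred nat -> R[i]} :=
  fun x => `[< has_ubound (range (normc \o x)) >].

Record linf := Linf { linf_val :> nat -> R[i]; _ : bounded_seq linf_val }.

HB.instance Definition _ := [isSub for linf_val].
HB.instance Definition _ := [Choice of linf by <:].

Lemma bounded_seqP (x : nat -> R[i]) :
  reflect (exists M : R, forall n, normc (x n) <= M) (x \in bounded_seq).
Proof.
apply: (iffP (asboolP _)) => -[M xM]; exists M.
  by move=> n; apply: xM; exists n.
by move=> _ [n _ <-]; exact: xM.
Qed.

Let bounded_subring : subring_closed bounded_seq.
Proof.
split=> [|x y /bounded_seqP[M xM] /bounded_seqP[N yN]
         |x y /bounded_seqP[M xM] /bounded_seqP[N yN]]; apply/bounded_seqP.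
- by exists 1 => n; rewrite normc1.
- exists (M + N) => n; apply: le_trans (le_normcD _ _) _.
  by rewrite normcN lerD.
- exists (M * N) => n; rewrite [(x * y) n]/(x n * y n) normcM.
  by apply: ler_pM => //; case: (_ n) => a b; exact: sqrtr_ge0.
Qed.

HB.instance Definition _ :=
  GRing.isSubringClosed.Build (nat -> R[i]) bounded_seq bounded_subring.

HB.instance Definition _ := [SubChoice_isSubComNzRing of linf by <:].

Let bounded_scale : GRing.scaler_closed bounded_seq.
Proof.
move=> a x /bounded_seqP[M xM]; apply/bounded_seqP; exists (normc a * M) => n.
rewrite [(a *: x) n]/(a * x n) normcM ler_wpM2l//.
by case: (a) => b c; exact: sqrtr_ge0.
Qed.

HB.instance Definition _ :=
  GRing.isScaleClosed.Build R[i] (nat -> R[i]) bounded_seq bounded_scale.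

HB.instance Definition _ := [SubZmodule_isSubLmodule of linf by <:].

Let linf_scalerAl (a : R[i]) (x y : linf) : a *: (x * y) = a *: x * y.
Proof. by apply/val_inj/funext => n; rewrite /= [LHS]mulrA. Qed.

HB.instance Definition _ :=
  GRing.Lmodule_isLalgebra.Build R[i] linf linf_scalerAl.
HB.instance Definition _ := GRing.Lalgebra_isComAlgebra.Build R[i] linf.

Let le_linf_sup (x : linf) n : normc (x n) <= sup (range (normc \o x)).
Proof.
by apply: ub_le_sup; [apply/asboolP; exact: (valP x) | exists n].
Qed.

Let linf_sup_le (x : linf) (M : R) :
  (forall n, normc (x n) <= M) -> sup (range (normc \o x)) <= M.
Proof.
move=> xM; apply: ge_sup; first by exists (normc (x 0)), 0.
by move=> _ [n _ <-]; exact: xM.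
Qed.

(* Normed modules over R[i] have their norm in R[i]. *)
Definition linf_norm (x : linf) : R[i] := (sup (range (normc \o x)))%:C.

Let linf_normD (x y : linf) :
  linf_norm (x + y) <= linf_norm x + linf_norm y.
Proof.
rewrite /linf_norm -rmorphD lecR; apply: linf_sup_le => n.
by apply: le_trans (le_normcD _ _) _; rewrite lerD ?le_linf_sup.
Qed.

Let linf_normZ (a : R[i]) (x : linf) : linf_norm (a *: x) = `|a| * linf_norm x.
Proof.
have normc_ge0 (z : R[i]) : 0 <= normc z by case: z => ? ?; exact: sqrtr_ge0.
have -> : `|a| = (normc a)%:C by [].
rewrite /linf_norm -rmorphM; congr (_%:C); apply/eqP; rewrite eq_le.
apply/andP; split.
  apply: linf_sup_le => n; rewrite [X in normc X]/(a * x n) normcM.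
  by rewrite ler_wpM2l ?le_linf_sup.
have [->|a0] := eqVneq a 0.
  rewrite normc0 mul0r; apply: le_trans (le_linf_sup _ 0).
  exact: normc_ge0.
have na0 : 0 < normc a.
  by rewrite lt_neqAle normc_ge0 andbT eq_sym; apply: contra_neq a0 => /eq0_normc.
rewrite -ler_pdivlMl//; apply: linf_sup_le => n.
rewrite ler_pdivlMl// -normcM; exact: (le_linf_sup (a *: x) n).
Qed.

Let linf_norm0_eq0 (x : linf) : linf_norm x = 0 -> x = 0.
Proof.
move=> [x0]; apply/val_inj/funext => n; apply: eq0_normc; apply/eqP.
rewrite eq_le -{1}x0 le_linf_sup/=.
by case: (_ n) => ? ?; exact: sqrtr_ge0.
Qed.

HB.instance Definition _ := @Lmodule_isNormed.Build R[i] linf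
  linf_norm linf_normD linf_normZ linf_norm0_eq0.

Let bounded_conj (x : linf) : bounded_seq (fun n => (x n)^*).
Proof.
have /bounded_seqP[M xM] := valP x; apply/bounded_seqP; exists M => n.
by apply: le_trans (xM n); rewrite /=; case: (_ n) => a b /=; rewrite sqrrN.
Qed.

Definition linf_star (x : linf) : linf := Linf (bounded_conj x).

Definition selfadjoint : set linf := [set x | linf_star x = x].

Definition star_closed (B : set linf) : Prop :=
  forall x, B x -> B (linf_star x).

Definition c0 : set linf :=
  [set x | (linf_val x : nat -> R[i]^o) @ \oo --> (0 : R[i]^o)].

(* A generating set of a *-closed subalgebra must consist of self-adjoint
   elements; for the other subalgebras there is no such restriction. *)
Definition generates (B S : set linf) : Prop :=
  [/\ S !=set0, S `<=` B, star_closed B -> S `<=` selfadjoint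
    & algspan S = B].

Definition cstar_generates (B S : set linf) : Prop :=
  [/\ S !=set0, S `<=` B `&` selfadjoint & closure (algspan S) = B].

Definition cstar_subalgebra (B : set linf) : Prop :=
  [/\ subalgebra B, star_closed B & closed B].

Definition genalgebrable (M : set linf) (T U : Type)
    (D : set T) (K : set U) : Prop :=
  exists B : set linf,
    [/\ subalgebra B, B `<=` M `|` [set 0], has_dim B D
      & least_card (generates B) K].

Definition cstar_genalgebrable (M : set linf) (T U : Type)
    (D : set T) (K : set U) : Prop :=
  exists B : set linf,
    [/\ cstar_subalgebra B, B `<=` M `|` [set 0], has_dim B D
      & least_card (cstar_generates B) K].

Definition linf_minus_c0 : set linf := ~` c0 `|` [set 0].

End Linf.

Arguments c0 : clear implicits.
Arguments linf_minus_c0 : clear implicits.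

(* Main.v *)
Require Import Defs.
From mathcomp Require Import all_boot all_order all_algebra.

(** Every algebra below is spanned or generated by sequences whose values can be
    prescribed infinitely often, so that no nonzero element is a null sequence;
    what has to be controlled is the number of generators.

    Finite dimension.  Multiplication by an element x of a finite-dimensional
    subalgebra B acts on a basis e by a matrix, and (e_1(n), .., e_k(n)), unless
    it is zero, is an eigenvector for x(n); so x takes finitely many values
    ([findim_finval]).  By interpolation ([finval_algspan]) B is then spanned by
    finitely many idempotents p_i, and sum_i 2^i p_i generates B, because each p_i
    is a binary digit of it.  Conversely the d-periodic sequences have dimension d.

    Closed algebras and countable dimension.  There are continuum many sequences
    [coord t] with values in [0, 1] such that any finite number of them takes any
    tuple of rational values infinitely often ([coord_hit]).  The algebra
    generated by the coordinates t in K is thus an algebra of functions on the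
    cube [0, 1]^K.  Its closure has dimension the continuum because it contains
    the linearly independent x / (1 - a x), for x a coordinate and continuum many
    reals a.  That no generating set S is smaller than K is seen as follows.
    - If S is infinite, each element of S depends on countably many coordinates
      only, and every coordinate of K has to be used; so K is covered by countable
      sets indexed by S, and |S x N| = |S| ([card_le_bigcup]).
    - If S consists of n real sequences f_j, it cannot generate n + 1 coordinates
      ([coord_dimension]).  Otherwise let g_i be polynomials in f that
      approximate these coordinates.  By a discrete Poincare-Miranda theorem
      ([approx_onto]) the point (g_0, .., g_n) comes arbitrarily close to every
      point of the cube [1/4, 3/4]^(n+1).  But it is a Lipschitz function of f,
      whose values lie in a box of dimension n, and a grid of mesh 1/M has of the
      order of M^(n+1) points in the cube and of M^n in the box.
    The Poincare-Miranda theorem comes from Kuhn's cubical version of Sperner's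
    lemma ([kuhn_lemma]), proved by cup products modulo 2: if h_i is 0 where
    x_i = 0 and 1 where x_i is maximal, then the cup product of the coboundaries
    of the h_i has integral 1 over the grid by Stokes' formula, hence does not
    vanish on some small cube, where every h_i must therefore change its value.

    Uncountable dimension.  The indicators of the sets of indices n whose n-th
    rational is below r, for a real r, form a chain closed under products.  The
    span of those with r in D has these indicators as a basis, and an element
    of it involves finitely many r only, whence again |D| <= |S x N| for every
    generating set S ([rat_cut_genalgebrable]). *)

Set Implicit Arguments.
Unset Strict Implicit.
Unset Printing Implicit Defensive.
Import Order.TTheory GRing.Theory Num.Theory.
Local Open Scope ring_scope.

(** * Cup products modulo 2 and Kuhn's lemma *)

Section Cup.
Variables (I : finType) (K : eqType) (V : zmodType) (e : I -> V).
Variable h : K -> V -> 'F_2.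
Local Notation F2 := 'F_2.

Lemma F2_addxx (x : F2) : x + x = 0.
Proof. by apply: addrr_pchar2; rewrite pchar_Fp. Qed.

(** With e the coordinate directions and h_k functions on the grid, this is the
    value on the cube with corner v and directions J of the cup product of the
    coboundaries of the h_k, for k in hs: a sum over the monotone edge paths from
    v to the opposite corner, each edge contributing the variation of the h_k whose turn it is. *)
Fixpoint cup (hs : seq K) (J : {set I}) (v : V) : F2 :=
  if hs is k :: hs' then
    \sum_(j in J) (h k (v + e j) + h k v) * cup hs' (J :\ j) (v + e j)
  else 1.

Lemma F2_sum_sym (J : {set I}) (G : I -> I -> F2) :
  (forall i j, G i j = G j i) -> \sum_(i in J) \sum_(j in J :\ i) G i j = 0.
Proof.
move=> Gs.
suff main (s : seq I) : uniq s ->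
    \sum_(i <- s) \sum_(j <- s | j != i) G i j = 0.
  rewrite -[RHS](main _ (enum_uniq J)) big_enum /=.
  apply: eq_bigr => i _; rewrite big_enum_cond /=.
  by apply: eq_bigl => j; rewrite !inE andbC.
elim: s => [|x s IH]; first by rewrite big_nil.
move=> /= /andP[xs us]; rewrite big_cons big_cons eqxx /=.
have -> : \sum_(i <- s) \sum_(j <- x :: s | j != i) G i j =
   \sum_(i <- s) G i x + \sum_(i <- s) \sum_(j <- s | j != i) G i j.
  rewrite -big_split /= !big_seq; apply: eq_bigr => i si.
  rewrite big_cons; case: eqP => //= xi.
  by move: xs; rewrite xi si.
rewrite IH // addr0.
have -> : \sum_(j <- s | j != x) G x j = \sum_(i <- s) G i x.
  rewrite [LHS]big_mkcond /= !big_seq; apply: eq_bigr => i si.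
  by case: eqP => [ix|_]; [move: xs; rewrite -ix si|rewrite Gs].
exact: F2_addxx.
Qed.

Lemma F2_eq (x y : F2) : x + y = 0 -> x = y.
Proof. by move=> xy; rewrite -[x]addr0 -(F2_addxx y) addrA xy add0r. Qed.

Lemma sum_swap2 (J : {set I}) (G : I -> I -> F2) :
  \sum_(i in J) \sum_(j in J :\ i) G i j = \sum_(i in J) \sum_(j in J :\ i) G j i.
Proof.
rewrite (exchange_big_dep (mem J)) /=; last by move=> i j _; rewrite !inE => /andP[].
apply: eq_bigr => j jJ; apply: eq_bigl => i.
by rewrite !inE jJ andbT eq_sym andbC.
Qed.

(** A cup product of coboundaries is closed: its integral over the boundary of
    a cube with one more direction is zero, that is, opposite faces have the same
    total.  Induction on the number of factors; in the double sums over two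
    directions j and l all terms symmetric in j and l cancel modulo 2. *)
Lemma cup_closed hs (J : {set I}) v : #|J| = (size hs).+1 ->
  \sum_(j in J) cup hs (J :\ j) (v + e j) = \sum_(j in J) cup hs (J :\ j) v.
Proof.
elim: hs J v => [|k hs IH] J v cJ //.
have IH' j w : j \in J ->
    \sum_(l in J :\ j) cup hs (J :\ j :\ l) (w + e l) =
    \sum_(l in J :\ j) cup hs (J :\ j :\ l) w.
  by move=> jJ; apply: IH; move: (cardsD1 j J); rewrite jJ cJ add1n => -[].
have swapD j l : J :\ j :\ l = J :\ l :\ j by rewrite setDDl setUC -setDDl.
transitivity (\sum_(j in J) \sum_(l in J :\ j)
   h k (v + e j) * cup hs (J :\ j :\ l) (v + e j + e l)).
  apply: F2_eq; rewrite -big_split /=.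
  rewrite -[RHS](@F2_sum_sym J (fun j l =>
     h k (v + e j + e l) * cup hs (J :\ j :\ l) (v + e j + e l))); last first.
    by move=> i j; rewrite swapD [v + e i + e j]addrAC.
  apply: eq_bigr => j _; rewrite -big_split /=; apply: eq_bigr => l _.
  by rewrite mulrDl -addrA F2_addxx addr0.
transitivity (\sum_(j in J) \sum_(l in J :\ j)
   h k (v + e j) * cup hs (J :\ j :\ l) (v + e j)).
  by apply: eq_bigr => j jJ; rewrite -!mulr_sumr IH'.
rewrite sum_swap2 /=.
under [RHS]eq_bigr => j _ do under eq_bigr => l _ do rewrite mulrDl.
under [RHS]eq_bigr => j _ do rewrite big_split /=.
rewrite [RHS]big_split /= [X in _ = _ + X](_ : _ = 0) ?addr0.
  by apply: eq_bigr => j _; apply: eq_bigr => l _; rewrite swapD.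
under eq_bigr => j jJ do rewrite -mulr_sumr (IH' _ _ jJ).
by rewrite -mulr_sumr F2_sum_sym ?mulr0// => i j; rewrite swapD.
Qed.

(** As the product over hs is closed, adding the coboundary of h_k in front
    yields a coboundary: the sum of the variations of h_k times the product
    over hs, between opposite faces. *)
Lemma cup_stokes k hs (J : {set I}) v : #|J| = (size hs).+1 ->
  cup (k :: hs) J v = \sum_(j in J) (h k (v + e j) * cup hs (J :\ j) (v + e j)
                                     + h k v * cup hs (J :\ j) v).
Proof.
move=> cJ; rewrite big_split /= -mulr_sumr -(cup_closed _ cJ) mulr_sumr -big_split /=.
by apply: eq_bigr => j _; rewrite mulrDl.
Qed.

Lemma cup_neq0 hs (J : {set I}) v k : cup hs J v != 0 -> k \in hs ->
  exists A B : {set I}, [/\ A \subset J, B \subset J &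
    h k (v + \sum_(i in A) e i) != h k (v + \sum_(i in B) e i)].
Proof.
elim: hs J v => // g hs IH J v /= nz hin.
have [j jJ] : exists2 j, j \in J &
    (h g (v + e j) + h g v) * cup hs (J :\ j) (v + e j) != 0.
  apply/exists_inP; apply: contra_neqT nz; rewrite negb_exists_in => /forall_inP z.
  by apply: big1 => j jJ; apply/eqP/negPn/z.
rewrite mulf_eq0 negb_or => /andP[gne cne].
move: hin; rewrite inE => /predU1P[->|hin].
  exists [set j], set0; split; rewrite ?sub0set ?sub1set// big_set1 big_set0 addr0.
  by apply: contra_neq gne => ->; rewrite F2_addxx.
have [A [B [AJ BJ AB]]] := IH _ _ cne hin.
have jn (C : {set I}) : C \subset J :\ j -> j |: C \subset J /\
    v + \sum_(i in j |: C) e i = v + e j + \sum_(i in C) e i.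
  rewrite subsetD1 => /andP[CJ jC]; rewrite subUset sub1set jJ CJ; split=> //.
  by rewrite big_setU1 //= addrA.
have [? eA] := jn _ AJ; have [? eB] := jn _ BJ.
by exists (j |: A), (j |: B); rewrite eA eB.
Qed.

Lemma cup_eq0 hs (J : {set I}) v k : k \in hs ->
  (forall A B : {set I}, A \subset J -> B \subset J ->
    h k (v + \sum_(i in A) e i) = h k (v + \sum_(i in B) e i)) ->
  cup hs J v = 0.
Proof.
move=> hin hc; apply/eqP/negPn/negP => /cup_neq0 -/(_ _ hin)[A [B [AJ BJ]]].
by rewrite (hc A B) // eqxx.
Qed.

End Cup.

Section Kuhn.
Variables (n N : nat).
Local Notation V := {ffun 'I_n -> 'I_N.+1}.
Variable h : 'I_n -> V -> 'F_2.
Hypothesis h0 : forall i (v : V), v i = ord0 -> h i v = 0.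
Hypothesis h1 : forall i (v : V), v i = ord_max -> h i v = 1.

Definition unit_step (i : 'I_n) : V := [ffun j => if j == i then inZp 1 else 0].
Local Notation e := unit_step.

(** The grid points of the face on which the first k coordinates are maximal,
    as lower corners: the other coordinates are not maximal. *)
Definition face (k : nat) : pred V :=
  [pred v : V | [forall i : 'I_n, (v i == ord_max) == (i < k)%N]].
(** Membership in the face, without the condition on the coordinate j. *)
Definition face_off (k : nat) (j : 'I_n) : pred V := [pred v : V |
  [forall i : 'I_n, (i != j) ==> ((v i == ord_max) == (i < k)%N)]].
Definition free_coords (k : nat) : {set 'I_n} := [set i : 'I_n | (k <= i)%N].

Lemma sum_step_out (A : {set 'I_n}) (v : V) i : i \notin A ->
  (v + \sum_(j in A) e j) i = v i.
Proof.
move=> iA; rewrite ffunE sum_ffunE big1 ?addr0// => j jA.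
by rewrite ffunE; case: eqP => // ij; rewrite ij jA in iA.
Qed.

Lemma sum_step_in (A : {set 'I_n}) (v : V) i : i \in A -> v i != ord_max ->
  (v + \sum_(j in A) e j) i = (v i).+1 :> nat.
Proof.
move=> iA vi; have vN : (v i < N)%N by rewrite ltn_neqAle vi -ltnS ltn_ord.
rewrite ffunE sum_ffunE (bigD1 i)// big1; last first.
  by move=> j /andP[_ ji]; rewrite ffunE eq_sym (negPf ji).
by rewrite Monoid.mulm1 ffunE eqxx /= modnDmr addn1 modn_small.
Qed.

(** Addition is cyclic here, so that the shift by e_j is a bijection of the grid
    and telescoping is a reindexing followed by cancellation modulo 2. *)
Lemma sum_telescope (j : 'I_n) (P : pred V) (G : V -> 'F_2) :
  (forall v, P (v + e j) = P v) ->
  \sum_(v | P v && (v j != ord_max)) (G (v + e j) + G v) =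
  \sum_(v | P v && (v j == ord_max)) G v + \sum_(v | P v && (v j == ord0)) G v.
Proof.
move=> Pj; rewrite big_split /=.
have -> : \sum_(v | P v && (v j != ord_max)) G (v + e j) =
          \sum_(v | P v && (v j != ord0)) G v.
  rewrite [RHS](reindex_inj (addIr (e j))) /=; apply: eq_bigl => v.
  rewrite Pj; congr (_ && ~~ _).
  have -> : (v + e j) j = v j + inZp 1 by rewrite !ffunE eqxx.
  apply/eqP/eqP => [->|/(congr1 val)] /=.
    by apply: val_inj => /=; rewrite modnDmr addn1 modnn.
  rewrite modnDmr addn1 => d; apply: val_inj => /=.
  have := ltn_ord (v j); rewrite ltnS leq_eqVlt => /predU1P[//|lt].
  by move: d; rewrite modn_small.
have split2 (Q : pred V) : \sum_(v | P v) G v =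
    \sum_(v | P v && Q v) G v + \sum_(v | P v && ~~ Q v) G v.
  by rewrite (bigID Q).
have e0 := split2 (fun v => v j == ord0); have e1 := split2 (fun v => v j == ord_max).
apply: F2_eq.
transitivity (\sum_(v | P v) G v + \sum_(v | P v) G v); last exact: F2_addxx.
rewrite {1}e0 {1}e1 [RHS]addrACA [RHS]addrC; congr (_ + _); exact: addrC.
Qed.

Lemma face_off_shift k j v : face_off k j (v + e j) = face_off k j v.
Proof.
apply: eq_forallb => i; case: eqVneq => //= ij.
by have := @sum_step_out [set j] v i; rewrite inE big_set1 => -> //.
Qed.

Lemma face_split k j v :
  face k v = face_off k j v && ((v j == ord_max) == (j < k)%N).
Proof.
apply/forallP/andP => [H|[/forallP H Hj] i].
  by split=> //; apply/forallP => i; apply/implyP.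
by case: (eqVneq i j) => [->//|ij]; have := H i; rewrite ij.
Qed.

Lemma mem_drop_enum k (j : 'I_n) : (j \in drop k (enum 'I_n)) = (k <= j)%N.
Proof.
rewrite -(mem_map val_inj) map_drop val_enum_ord drop_iota mem_iota add0n.
by case: (leqP k j) => //= kj; rewrite subnKC ?ltn_ord// ltnW// (leq_ltn_trans kj).
Qed.

Lemma card_free_coords k : #|free_coords k| = size (drop k (enum 'I_n)).
Proof.
rewrite -(card_uniqP (drop_uniq k (enum_uniq 'I_n))).
by apply: eq_card => j; rewrite inE mem_drop_enum.
Qed.

(** By Stokes' formula the integral of the remaining factors over a face
    is the integral of h_k times the later factors over its boundary.  On the
    sides x_j = const with j > k the factor h_j is constant and kills the product;
    on x_k = 0 the function h_k vanishes; on the maximal side of x_k it is 1, and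
    the integral over the next face remains. *)
Lemma cup_sum_face k : (k <= n)%N ->
  \sum_(v | face k v) cup e h (drop k (enum 'I_n)) (free_coords k) v = 1.
Proof.
elim: {k}(n - k)%N {-2}k (erefl (n - k)%N) => [|m IH] k nk kn.
  have {nk kn} -> : k = n by apply/eqP; rewrite eqn_leq kn -subn_eq0 nk.
  rewrite drop_oversize ?size_enum_ord //= (big_pred1 [ffun => ord_max]) // => v.
  apply/forallP/eqP => [H|-> i]; last by rewrite ffunE eqxx ltn_ord.
  by apply/ffunP => i; rewrite ffunE; apply/eqP; rewrite (eqP (H i)) ltn_ord.
have kn' : (k < n)%N by rewrite -subn_gt0 nk.
pose k' := Ordinal kn'.
have dropk : drop k (enum 'I_n) = k' :: drop k.+1 (enum 'I_n).
  rewrite (drop_nth k') ?size_enum_ord//; congr (_ :: _).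
  by apply: val_inj => /=; rewrite nth_enum_ord.
have clater : #|free_coords k| = (size (drop k.+1 (enum 'I_n))).+1.
  by rewrite card_free_coords dropk.
rewrite dropk.
under eq_bigr => v _ do rewrite cup_stokes //.
rewrite exchange_big /= (bigD1 k') /=; last by rewrite inE /= leqnn.
have tele (j : 'I_n) (G : V -> 'F_2) : (k <= j)%N ->
    \sum_(v | face k v) (G (v + e j) + G v) =
      \sum_(v | face_off k j v && (v j == ord_max)) G v +
      \sum_(v | face_off k j v && (v j == ord0)) G v.
  move=> kj; rewrite -sum_telescope; last by move=> v; apply: face_off_shift.
  apply: eq_bigl => v; rewrite (face_split k j) ltnNge kj /=.
  by rewrite eqbF_neg.
rewrite [X in _ + X]big1 ?addr0.
  rewrite (tele k' (fun v => h k' v * cup e h _ _ v)) //= [X in _ + X]big1 ?addr0.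
    rewrite -[RHS](IH k.+1) //; last by rewrite subnS nk.
    apply: eq_big => [v|v /andP[_ /eqP vk]].
      have -> := face_split k.+1 k' v; rewrite /= ltnSn eqb_id; congr (_ && _).
      apply: eq_forallb => i; case: eqVneq => //= ik.
      rewrite ltnS [in RHS]leq_eqVlt (_ : (i == k :> nat) = false) //.
      by apply: contraNF ik => /eqP ik; apply/eqP/val_inj.
    rewrite h1 // mul1r; congr (cup _ _ _ _ _).
    by apply/setP => i; rewrite !inE [RHS]ltn_neqAle eq_sym.
  by move=> v /andP[_ /eqP vk]; rewrite h0 // mul0r.
move=> j /andP[jk jk'].
have {}jk : (k < j)%N.
  by rewrite inE in jk; rewrite ltn_neqAle jk andbT eq_sym.
have jin : j \in drop k.+1 (enum 'I_n) by rewrite mem_drop_enum.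
have out (A : {set 'I_n}) v : A \subset free_coords k :\ j -> (v + \sum_(i in A) e i) j = v j.
  by rewrite subsetD1 => /andP[_ jA]; rewrite sum_step_out.
rewrite (tele j (fun v => h k' v * cup e h _ _ v)) ?(ltnW jk)// !big1 ?addr0//.
  move=> v /andP[_ /eqP vj]; rewrite (cup_eq0 jin) ?mulr0// => A B AJ BJ.
  by rewrite !h0 ?out.
move=> v /andP[_ /eqP vj]; rewrite (cup_eq0 jin) ?mulr0// => A B AJ BJ.
by rewrite !h1 ?out.
Qed.

(** Kuhn's cubical form of Sperner's lemma: some small cube of the grid sees both
    values of every h_i. *)
Lemma kuhn_lemma : exists2 v : V, (forall i, v i != ord_max) &
  forall i, exists A B : {set 'I_n},
    h i (v + \sum_(j in A) e j) != h i (v + \sum_(j in B) e j).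
Proof.
have /eqP := cup_sum_face (leq0n n); rewrite drop0 => S1.
have [v fv nz] : exists2 v, face 0 v & cup e h (enum 'I_n) (free_coords 0) v != 0.
  apply/exists_inP; apply: contraTT S1; rewrite negb_exists_in => /forall_inP z.
  by rewrite big1 // => v /z /negPn/eqP.
exists v => i; first by have /forallP/(_ i) := fv; rewrite ltn0 eqbF_neg.
have [|A [B [_ _ AB]]] := cup_neq0 nz (_ : i \in _); first exact: mem_enum.
by exists A, B.
Qed.

End Kuhn.
(** * Cardinalities *)

(* From here on the set notations are those for arbitrary sets, no longer those
   for finite sets. *)
From mathcomp Require Import all_classical all_reals all_analysis.
From mathcomp Require Import complex zify ring lra.
Import Order.TTheory GRing.Theory Num.Theory numFieldNormedType.Exports.
Import ComplexField.Normc.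
Local Open Scope classical_set_scope.
Local Open Scope complex_scope.
Local Open Scope card_scope.

Lemma card_le_inj (T U : Type) (A : set T) (B : set U) (f : T -> U) :
  set_fun A B f -> set_inj A f -> A #<= B.
Proof.
by move=> AB fi; have [g] := injfunPex.2 (ex_intro2 _ _ f AB fi); exact: inj_card_le g.
Qed.

Lemma card_le_surj (T U : Type) (A : set T) (B : set U) (g : U -> T) :
  A `<=` g @` B -> A #<= B.
Proof. by move=> AgB; have [h] := surjPex.2 (ex_intro _ g AgB); exact: surj_card_ge h. Qed.

Lemma card_le_injP (T U : Type) (A : set T) (B : set U) : A !=set0 -> A #<= B ->
  exists2 f : T -> U, set_fun A B f & set_inj A f.
Proof.
elim/Ppointed: U => U in B *.
  by rewrite emptyE => -[x Ax] /eqP A0; rewrite A0 in Ax.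
by move=> _ /pcard_leP[f]; apply/injfunPex; squash f.
Qed.

(** A maximal family E of disjoint injective sequences in S exhausts S up to a
    countable set Q.  Hence S is coded injectively by pairs of a sequence of E and
    an index, and pairing the index with a further integer gives an injection of
    the product with nat back into S. *)
Lemma card_mul_nat (T : Type) (S : set T) : infinite_set S ->
  S `*` [set: nat] #<= S.
Proof.
move=> Sinf.
pose D := [set u : nat -> T | injective u /\ range u `<=` S].
have [E [ED tE maxE]] := ex_maximal_disjoint_subcollection (fun u : nat -> T => range u) D.
pose Q := S `\` \bigcup_(u in E) range u.
have Qcount : countable Q.
  have [/finite_set_countable//|/infiniteP Qinf] := pselect (finite_set Q).
  have [u uQ /in2TT ui] := card_le_injP (ex_intro _ 0%N I) Qinf.
  have uQ' k : Q (u k) by exact: uQ.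
  have Eu : ~ E u by move=> Eu; case: (uQ' 0%N) => _; apply; exists u => //; exists 0%N.
  exfalso; apply: (maxE (u |` E)).
  - by split=> [w Ew|e]; [right|apply: Eu; apply: e; left].
  - move=> w [->|/ED//]; split; first by move=> i j; apply: ui.
    by move=> _ [k _ <-]; have [] := uQ' k.
  - move=> a b [->|Ea] [->|Eb] //; last exact: tE.
      by move=> [_ [[i _ <-] bi]]; exfalso; case: (uQ' i) => _; apply; exists b.
    by move=> [x [ai [i _ ib]]]; exfalso; case: (uQ' i) => _; apply; exists a; rewrite // ib.
have [u0 Eu0] : E !=set0.
  apply/set0P/eqP => E0; exfalso; have [s0 Ss0] := infinite_setN0 Sinf.
  have /infiniteP sinj := Sinf; have [u uS ui] := card_le_injP (ex_intro _ 0%N I) sinj.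
  apply: (maxE [set u]); rewrite ?E0.
  - by split=> // /(_ u erefl).
  - move=> _ ->; split; first by move=> i j; apply: ui; rewrite in_setT.
    by move=> _ [k _ <-]; apply: uS.
  - by move=> a b -> ->.
have [r rinj] := countable_injP _ Qcount.
(* Odd indices code the points on the sequences of E, even indices on the
   sequence u0 the points of Q. *)
have ex x : exists p : (nat -> T) * nat, S x -> E p.1 /\
    ((exists2 k, p.2 = k.*2.+1 & p.1 k = x) \/ [/\ Q x, p.1 = u0 & p.2 = (r x).*2]).
  have [Sx|] := pselect (S x); last by move=> nS; exists (u0, 0%N).
  have [[u Eu [k _ ukx]]|nD] := pselect ((\bigcup_(u in E) range u) x).
    by exists (u, k.*2.+1) => _; split=> //; left; exists k.
  by exists (u0, (r x).*2) => _; split=> //; right; split.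
have [p pP] := choice ex.
apply: (@card_le_inj _ _ _ _ (fun xj => (p xj.1).1 (choice.pickle ((p xj.1).2, xj.2)))).
  by move=> [x j] [/= /pP[/ED[_ h] _] _]; apply: h; exists (choice.pickle ((p x).2, j)).
move=> [x j] [y k]; rewrite !inE => -[/= Sx _] [/= Sy _] /= eq.
have [Ex ox] := pP _ Sx; have [Ey oy] := pP _ Sy.
have pxy : (p x).1 = (p y).1.
  apply: (tE _ _ Ex Ey); exists ((p x).1 (choice.pickle ((p x).2, j))).
  by split; [eexists|rewrite eq; eexists].
have [] := ED _ Ex => inj _; move: eq; rewrite -pxy => /inj/(pcan_inj choice.pickleK)[i2 ->].
congr (_, _).
case: ox => [[a xa <-]|[Qx x0 xr]]; case: oy => [[b yb <-]|[Qy y0 yr]].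
- by move: i2; rewrite xa yb pxy => -[/double_inj ->].
- by move: i2; rewrite xa yr => /(congr1 odd); rewrite /= !odd_double.
- by move: i2; rewrite xr yb => /(congr1 odd); rewrite /= !odd_double.
- by move: i2; rewrite xr yr => /double_inj; apply: rinj; rewrite inE.
Qed.

Lemma card_le_bigcup (T U : Type) (K : set T) (S : set U) (F : U -> set T) :
  infinite_set S -> K `<=` \bigcup_(s in S) F s ->
  (forall s, S s -> countable (F s)) -> K #<= S.
Proof.
move=> Sinf KF Fc; apply: card_le_trans (card_mul_nat Sinf).
have ex s : exists f : T -> nat, S s -> {in F s &, injective f}.
  have [Ss|nS] := pselect (S s); last by exists (fun=> 0%N).
  by have /countable_injP[f fi] := Fc _ Ss; exists f.
have [f fP] := choice ex.
have [[t0 Kt0]|/set0P/negP] := pselect (K !=set0); last first.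
  by rewrite negbK => /eqP ->; exact: card_ge0.
have [s0 _ _] := KF _ Kt0.
have ex2 t : exists s, K t -> S s /\ F s t.
  have [Kt|nK] := pselect (K t); last by exists s0.
  by have [s Ss Fst] := KF _ Kt; exists s.
have [g gP] := choice ex2.
apply: (@card_le_inj _ _ _ _ (fun t => (g t, f (g t) t))).
  by move=> t /gP[].
move=> t t'; rewrite !inE => /gP[St Ft] /gP[St' Ft'] [gg].
by rewrite -gg; apply: fP => //; rewrite inE// gg.
Qed.

Lemma card_eqW (T U : Type) (A : set T) (B : set U) : A #= B -> A #<= B.
Proof. by rewrite card_eq_le => /andP[]. Qed.

Lemma card_eqWr (T U : Type) (A : set T) (B : set U) : A #= B -> B #<= A.
Proof. by rewrite card_eq_le => /andP[]. Qed.

Lemma card_ge1 (T : Type) (S : set T) : S !=set0 -> `I_1 #<= S.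
Proof.
move=> [s Ss]; apply: (card_le_trans (card_eqWr (card_set1 (x := s)))).
by apply: subset_card_le => _ ->.
Qed.

Lemma seq_image (T U : eqType) (f : T -> U) (A : set T) (s : seq U) :
  (forall y, y \in s -> (f @` A) y) -> exists2 r : seq T, (forall x, x \in r -> A x) & s = map f r.
Proof.
elim: s => [|y s IH] sA; first by exists [::].
have [|r rA ->] := IH; first by move=> z zs; apply: sA; rewrite inE zs orbT.
have [x Ax <-] := sA _ (mem_head _ _); exists (x :: r) => // z.
by rewrite inE => /predU1P[->|/rA].
Qed.

(** * Linear spans and generated algebras *)

Section LinearAlgebraTheory.
Context {K : fieldType} {V : lmodType K}.
Implicit Types B E : set V.

Definition subspace B : Prop :=
  [/\ B 0, (forall x y, B x -> B y -> B (x + y)) & (forall a x, B x -> B (a *: x))].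

Lemma subspace_sum B (I : Type) (r : seq I) (P : pred I) (F : I -> V) :
  subspace B -> (forall i, P i -> B (F i)) -> B (\sum_(i <- r | P i) F i).
Proof. by move=> [B0 BD _]; apply: big_ind. Qed.

Lemma sub_linspan E : E `<=` linspan E.
Proof.
move=> x Ex; exists 1%N, (fun=> 1), (fun=> x); split=> //.
by rewrite big_ord1 scale1r.
Qed.

Lemma linspan_subspace E : subspace (linspan E).
Proof.
split.
- exists 0%N, (fun=> 0), (fun=> 0); rewrite big_ord0; split=> //; case=> //.
- move=> _ _ [n [a [e [Ee ->]]]] [m [b [f [Ef ->]]]].
  exists (n + m)%N, (fun i => match fintype.split i with inl j => a j | inr k => b k end),
    (fun i => match fintype.split i with inl j => e j | inr k => f k end).
  split; first by move=> i; case: fintype.split.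
  rewrite big_split_ord; congr (_ + _); apply: eq_bigr => i _.
    by rewrite (unsplitK (inl i)).
  by rewrite (unsplitK (inr i)).
- move=> c _ [n [a [e [Ee ->]]]]; exists n, (fun i => c * a i), e; split=> //.
  by rewrite scaler_sumr; apply: eq_bigr => i _; rewrite scalerA.
Qed.

Lemma linspan_min E B : subspace B -> E `<=` B -> linspan E `<=` B.
Proof.
move=> sB EB _ [n [a [e [Ee ->]]]]; apply: subspace_sum => // i _.
by have [_ _ BZ] := sB; apply/BZ/EB.
Qed.

Lemma linspan_mono E E' : E `<=` E' -> linspan E `<=` linspan E'.
Proof.
move=> EE'; apply: linspan_min; first exact: linspan_subspace.
by move=> x /EE'; exact: sub_linspan.
Qed.

Lemma linspan_id B : subspace B -> linspan B = B.
Proof.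
by move=> sB; apply/seteqP; split; [apply: linspan_min|apply: sub_linspan].
Qed.

(** Collecting equal vectors makes the families in the definition of the span
    repetition-free. *)
Lemma linspan_seqP E x : linspan E x <-> exists (s : seq V) (a : V -> K),
  [/\ uniq s, forall y, y \in s -> E y & x = \sum_(y <- s) a y *: y].
Proof.
split; last first.
  move=> [s [a [_ sE ->]]]; rewrite big_seq; apply: subspace_sum.
    exact: linspan_subspace.
  by move=> y /sE/sub_linspan; have [_ _ sZ] := linspan_subspace E; apply: sZ.
apply: (@linspan_min E (fun x => exists (s : seq V) (a : V -> K),
  [/\ uniq s, forall y, y \in s -> E y & x = \sum_(y <- s) a y *: y])); last first.
  move=> y Ey; exists [:: y], (fun=> 1); split=> //.
    by move=> z; rewrite inE => /eqP ->.
  by rewrite big_seq1 scale1r.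
split.
- by exists [::], (fun=> 0); rewrite big_nil.
- move=> _ _ [s [a [us sE ->]]] [t [b [ut tE ->]]].
  exists (undup (s ++ t)), (fun y => (if y \in s then a y else 0) + (if y \in t then b y else 0)).
  split; first exact: undup_uniq.
    by move=> y; rewrite mem_undup mem_cat => /orP[/sE|/tE].
  have ext (r : seq V) (c : V -> K) : uniq r -> {subset r <= s ++ t} ->
      \sum_(y <- r) c y *: y = \sum_(y <- undup (s ++ t)) (if y \in r then c y else 0) *: y.
    move=> ur rst; rewrite [RHS](bigID (fun y => y \in r)) /= [X in _ + X]big1 ?addr0; last first.
      by move=> y /negPf ->; rewrite scale0r.
    transitivity (\sum_(y <- [seq y <- undup (s ++ t) | y \in r]) c y *: y).
      apply/perm_big/uniq_perm; rewrite ?filter_uniq ?undup_uniq// => y.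
      rewrite mem_filter mem_undup /=; case yr: (y \in r) => //=.
      by rewrite rst.
    by rewrite big_filter; apply: eq_bigr => y ->.
  rewrite (ext s a)// => [|y ys]; last by rewrite mem_cat ys.
  rewrite (ext t b)// => [|y yt]; last by rewrite mem_cat yt orbT.
  by rewrite -big_split /=; apply: eq_bigr => y _; rewrite scalerDl.
- move=> c _ [s [a [us sE ->]]]; exists s, (fun y => c * a y); split=> //.
  by rewrite scaler_sumr; apply: eq_bigr => i _; rewrite scalerA.
Qed.

Lemma lin_indepP E : lin_indep E <-> forall (s : seq V) (a : V -> K), uniq s ->
  (forall y, y \in s -> E y) -> \sum_(y <- s) a y *: y = 0 ->
  forall y, y \in s -> a y = 0.
Proof.
split=> [Ei s a us sE s0 y ys|H n a e ei eE s0 i].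
  have yi : (index y s < size s)%N by rewrite index_mem.
  have := Ei (size s) (fun i => a (tnth (in_tuple s) i)) (tnth (in_tuple s)).
  rewrite -(big_tnth _ _ s xpredT (fun y => a y *: y)) => /(_ _ _ s0 (Ordinal yi)).
  rewrite (tnth_nth y) /= nth_index //; apply; first by apply/tuple_uniqP.
  by move=> i; apply/sE/mem_tnth.
pose b x := if [pick i | e i == x] is Some i then a i else 0.
have be j : b (e j) = a j.
  by rewrite /b; case: pickP => [k /eqP/ei -> //|/(_ j)]; rewrite eqxx.
rewrite -be; apply: (H (map e (enum 'I_n))).
- by rewrite map_inj_uniq // enum_uniq.
- by move=> y /mapP[j _ ->].
- by rewrite big_map big_enum /= -[RHS]s0; apply: eq_bigr => j _; rewrite be.
- by rewrite map_f // mem_enum.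
Qed.

(** Steinitz exchange in infinite dimension, by Zorn's lemma. *)
Lemma basis_extension E0 G : lin_indep E0 -> E0 `<=` G ->
  exists F, [/\ E0 `<=` F, F `<=` G, lin_indep F & linspan F = linspan G].
Proof.
move=> iE0 E0G.
pose P (X : set V) := X `<=` G /\ lin_indep (E0 `|` X).
have [|X [[XG iX] maxX]] := @Zorn_bigcup V P.
  move=> C CP totC; split; first by move=> x [X /CP[XG _]] /XG.
  apply/lin_indepP => s a us sE.
  (* A finite part of the union of a chain lies in one member of the chain. *)
  suff [sE0|[X CX sX]] : (forall y, y \in s -> E0 y) \/
      (exists2 X, C X & forall y, y \in s -> (E0 `|` X) y).
  - exact: (lin_indepP E0).1.
  - by have [_ /lin_indepP iX] := CP _ CX; apply: iX.
  elim: s sE {us} => [|x s IH] sE; first by left.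
  have [|sE0|[X CX sX]] := IH.
  - by move=> y ys; apply: sE; rewrite inE ys orbT.
  - have [E0x|[X CX Xx]] := sE _ (mem_head x s).
      by left=> y; rewrite inE => /predU1P[->|/sE0].
    by right; exists X => // y; rewrite inE => /predU1P[->|/sE0]; [right|left].
  - right; have [E0x|[Y CY Yx]] := sE _ (mem_head x s).
      by exists X => // y; rewrite inE => /predU1P[->|/sX]; [left|].
    have [XY|YX] := totC _ _ CX CY.
      exists Y => // y; rewrite inE => /predU1P[->|/sX[]]; [by right|by left|].
      by right; apply: XY.
    exists X => // y; rewrite inE => /predU1P[->|/sX//].
    by right; apply: YX.
exists (E0 `|` X); split=> //.
  by move=> x [/E0G|/XG].
apply/seteqP; split; first by apply: linspan_mono => x [/E0G|/XG].
apply: linspan_min; first exact: linspan_subspace.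
move=> g Gg; apply: contrapT => gX; apply: (maxX (X `|` [set g])).
  split; first by move=> x; left.
  by move=> XgX; apply/gX/sub_linspan; right; apply: XgX; right.
split; first by move=> x [/XG|->].
apply/lin_indepP => s a us sE.
have [gs s0|gs] := boolP (g \in s); last first.
  apply: (lin_indepP _).1 iX _ a us _ => y ys.
  have [|[|yg]] := sE _ ys; [by left|by right|].
  by rewrite -yg ys in gs.
have rE y : y \in rem g s -> (E0 `|` X) y.
  rewrite mem_rem_uniq // inE => /andP[/eqP yg ys].
  by have [|[|/yg]] := sE _ ys; [left|right|].
have s0' : a g *: g + \sum_(y <- rem g s) a y *: y = 0.
  by rewrite -[RHS]s0 (big_rem g gs).
have ag : a g = 0.
  apply: contrapT => /eqP ag; apply: gX.
  have -> : g = - (a g)^-1 *: \sum_(y <- rem g s) a y *: y.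
    apply: (scalerI ag); rewrite scalerA mulrN divff // scaleN1r.
    by apply/eqP; rewrite -addr_eq0 s0'.
  have [_ _ sZ] := linspan_subspace (E0 `|` X); apply: sZ.
  by apply/linspan_seqP; exists (rem g s), a; split=> //; rewrite rem_uniq.
rewrite ag scale0r add0r in s0'.
have r0 := (lin_indepP _).1 iX _ a (rem_uniq g us) rE s0'.
move=> y ys; have [->//|yg] := eqVneq y g.
by apply: r0; rewrite mem_rem_uniq // inE yg.
Qed.

End LinearAlgebraTheory.

Section AlgebraTheory.
Context {K : fieldType} {A : algType K}.
Implicit Types B S : set A.

Lemma subalgebra_subspace B : subalgebra B -> subspace B.
Proof. by case. Qed.

Lemma sub_algspan S : S `<=` algspan S.
Proof.
move=> x Sx; apply: sub_linspan; exists [:: x]; last by rewrite big_seq1.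
by split=> // y; rewrite inE => /eqP ->.
Qed.

Lemma productsM S x y : products S x -> products S y -> products S (x * y).
Proof.
move=> [s [s0 sS] ->] [t [t0 tS] ->]; exists (s ++ t); last by rewrite big_cat.
split; first by case: s s0 {sS}.
by move=> z; rewrite mem_cat => /orP[/sS|/tS].
Qed.

Lemma linspan_subalgebra (E : set A) :
  (forall x y, E x -> E y -> linspan E (x * y)) -> subalgebra (linspan E).
Proof.
move=> EM; have [s0 sD sZ] := linspan_subspace E; split=> // x y Ex Ey.
move: x Ex; apply: (@linspan_min _ _ E (fun x => linspan E (x * y))).
  by split=> [|u v hu hv|a u hu]; rewrite ?mul0r ?mulrDl -?scalerAl; auto.
move=> x Ex; move: y Ey.
apply: (@linspan_min _ _ E (fun y => linspan E (x * y))) => [|y Ey]; last exact: EM.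
by split=> [|u v hu hv|a u hu]; rewrite ?mulr0 ?mulrDr -?scalerAr; auto.
Qed.

Lemma algspan_subalgebra S : subalgebra (algspan S).
Proof. by apply: linspan_subalgebra => x y Sx Sy; apply/sub_linspan/productsM. Qed.

Lemma algspan_min S B : subalgebra B -> S `<=` B -> algspan S `<=` B.
Proof.
move=> sB SB; apply: linspan_min; first exact: subalgebra_subspace.
have [_ _ _ BM] := sB; move=> _ [s [s0 sS] ->].
case: s s0 sS => // x s _; elim: s x => [|y s IH] x sS.
  by rewrite big_seq1; apply/SB/sS/mem_head.
rewrite big_cons; apply: BM; first by apply/SB/sS/mem_head.
by apply: IH => z zs; apply: sS; rewrite inE zs orbT.
Qed.

Lemma algspan_mono S S' : S `<=` S' -> algspan S `<=` algspan S'.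
Proof.
move=> SS'; apply: algspan_min; first exact: algspan_subalgebra.
by move=> x /SS'; exact: sub_algspan.
Qed.

(** An element of a generated algebra involves finitely many generators. *)
Lemma algspan_fin S x : algspan S x ->
  exists2 s : seq A, (forall y, y \in s -> S y) & algspan [set` s] x.
Proof.
move: x; apply: (@algspan_min S (fun x => exists2 s : seq A,
  (forall y, y \in s -> S y) & algspan [set` s] x)); last first.
  move=> x Sx; exists [:: x]; first by move=> y; rewrite inE => /eqP ->.
  by apply: sub_algspan; rewrite /= inE.
have catl (s t : seq A) : [set` s] `<=` [set` s ++ t].
  by move=> z /=; rewrite mem_cat => ->.
have catr (s t : seq A) : [set` t] `<=` [set` s ++ t].
  by move=> z /=; rewrite mem_cat orbC => ->.
split.
- by exists [::] => //; have [] := algspan_subalgebra [set` [::]].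
- move=> x y [s sS sx] [t tS ty]; exists (s ++ t).
    by move=> z; rewrite mem_cat => /orP[/sS|/tS].
  have [_ sD _ _] := algspan_subalgebra [set` s ++ t].
  by apply: sD; [apply: algspan_mono sx|apply: algspan_mono ty].
- move=> a x [s sS sx]; exists s => //.
  by have [_ _ sZ _] := algspan_subalgebra [set` s]; apply: sZ.
- move=> x y [s sS sx] [t tS ty]; exists (s ++ t).
    by move=> z; rewrite mem_cat => /orP[/sS|/tS].
  have [_ _ _ sM] := algspan_subalgebra [set` s ++ t].
  by apply: sM; [apply: algspan_mono sx|apply: algspan_mono ty].
Qed.

End AlgebraTheory.

(** * Bounded sequences *)

Section LinfTheory.
Context {R : realType}.
Local Notation C := R[i].
Local Notation linf := (linf R).
Implicit Types (x y z : linf) (A S : set linf).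

Lemma normc_ge0 (z : C) : 0 <= normc z.
Proof. by case: z => a b; exact: sqrtr_ge0. Qed.

Lemma normc_subC (a b : C) : normc (a - b) = normc (b - a).
Proof. by rewrite -normcN opprB. Qed.

Lemma normc_subD (b a c : C) : normc (a - c) <= normc (a - b) + normc (b - c).
Proof. by apply: le_trans (le_normcD _ _); rewrite subrKA. Qed.

Lemma normc_real (a : R) : normc (a%:C) = `|a|.
Proof. by rewrite /= expr0n addr0 sqrtr_sqr. Qed.

Lemma linf_eq x y : (forall n, x n = y n) -> x = y.
Proof. by move=> xy; apply/val_inj/funext. Qed.

Lemma linfD x y n : (x + y) n = x n + y n. Proof. by []. Qed.
Lemma linfM x y n : (x * y) n = x n * y n. Proof. by []. Qed.
Lemma linfZ (a : C) x n : (a *: x) n = a * x n. Proof. by []. Qed.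
Lemma linf0 n : (0 : linf) n = 0. Proof. by []. Qed.

Lemma linf_sum (I : Type) (r : seq I) (P : pred I) (F : I -> linf) n :
  (\sum_(i <- r | P i) F i) n = \sum_(i <- r | P i) F i n.
Proof. by apply: (big_morph (fun x : linf => x n)) => [x y|]. Qed.

Lemma linfX x k n : (x ^+ k) n = x n ^+ k.
Proof. by elim: k => [|k IH]; rewrite ?expr0 // !exprS linfM IH. Qed.

Lemma linf_bounded x : exists2 M : R, 0 < M & forall n, normc (x n) <= M.
Proof.
have /bounded_seqP[M xM] := valP x.
exists (`|M| + 1); first by rewrite ltr_wpDl.
by move=> n; apply: le_trans (xM n) _; rewrite (le_trans (ler_norm _)) ?lerDl.
Qed.

Lemma bounded_seq_le (f : nat -> C) (M : R) :
  (forall n, normc (f n) <= M) -> bounded_seq f.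
Proof. by move=> fM; apply/bounded_seqP; exists M. Qed.

Lemma linf_norm_lt (x : linf) (e : R) : `|x| < e%:C -> forall n, normc (x n) < e.
Proof.
rewrite [`|x|]/(linf_norm x) /linf_norm ltcR => xe n; apply: le_lt_trans xe.
by apply: ub_le_sup; [apply/asboolP; exact: (valP x)|exists n].
Qed.

Lemma linf_norm_le (x : linf) (e : R) : (forall n, normc (x n) <= e) -> `|x| <= e%:C.
Proof.
move=> xe; rewrite [`|x|]/(linf_norm x) /linf_norm lecR.
apply: ge_sup; first by exists (normc (x 0%N)), 0%N.
by move=> _ [n _ <-]; exact: xe.
Qed.

(** The norm is the supremum of the moduli of the terms, so closures are described
    by uniform approximation. *)
Lemma closureP A x : closure A x <-> forall e : R, 0 < e ->
  exists2 y, A y & forall n, normc (x n - y n) <= e.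
Proof.
split=> [cx e e0|H B /nbhs_ballP[e /= e0 eB]].
  have [|y [Ay xy]] := cx (ball x e%:C); first by apply: nbhsx_ballx; rewrite ltcR.
  exists y => // n; move: xy; rewrite -ball_normE /= => /linf_norm_lt/(_ n).
  exact: ltW.
have eE : e = (complex.Re e)%:C by apply/esym/RRe_real; rewrite gtr0_real.
have Re0 : 0 < complex.Re e by move: e0; rewrite {1}eE ltcR.
have [|y Ay xy] := H (complex.Re e / 2); first by rewrite divr_gt0.
exists y; split=> //; apply: eB; rewrite -ball_normE /= eE.
have /linf_norm_le : forall n, normc ((x - y) n) <= complex.Re e / 2 by [].
move/le_lt_trans; apply; rewrite ltcR; lra.
Qed.

Lemma c0P x : c0 R x <-> forall e : R, 0 < e ->
  exists N, forall n, (N <= n)%N -> normc (x n) <= e.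
Proof.
split=> [/cvgrPdist_le H e e0|H].
  have [|N _ Nx] := H e%:C; first by rewrite ltcR.
  by exists N => n /Nx /=; rewrite sub0r normrN lecR.
apply/cvgrPdist_le => e e0.
have eE : e = (complex.Re e)%:C by apply/esym/RRe_real; rewrite gtr0_real.
have [|N Nx] := H (complex.Re e); first by move: e0; rewrite {1}eE ltcR.
by exists N => // n /= /Nx; rewrite sub0r normrN [in X in _ -> X]eE lecR.
Qed.

Lemma sub_closure A : A `<=` closure A.
Proof. exact: subset_closure. Qed.

Lemma closure_idem A : closure (closure A) = closure A.
Proof. by rewrite -(closure_id (closure A)).1 //; exact: closed_closure. Qed.

Lemma closure_subalgebra A : subalgebra A -> subalgebra (closure A).
Proof.
move=> [A0 AD AZ AM]; split; first exact: sub_closure.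
- move=> x y /closureP cx /closureP cy; apply/closureP => e e0.
  have [|x' Ax xx] := cx (e / 2); first lra.
  have [|y' Ay yy] := cy (e / 2); first lra.
  exists (x' + y'); [exact: AD|move=> n].
  have -> : (x + y) n - (x' + y') n = (x n - x' n) + (y n - y' n) by rewrite !linfD; ring.
  by apply: le_trans (le_normcD _ _) _; have := xx n; have := yy n; lra.
- move=> a x /closureP cx; apply/closureP => e e0.
  have a1 : 0 < normc a + 1 by have := normc_ge0 a; lra.
  have [|x' Ax xx] := cx (e / (normc a + 1)); first by rewrite divr_gt0.
  exists (a *: x'); [exact: AZ|move=> n].
  rewrite !linfZ -mulrBr normcM.
  apply: (@le_trans _ _ ((normc a + 1) * normc (x n - x' n))).
    by rewrite ler_wpM2r ?normc_ge0 ?lerDl.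
  by rewrite mulrC -ler_pdivlMr.
- move=> x y /closureP cx /closureP cy; apply/closureP => e e0.
  have [M M0 xM] := linf_bounded x; have [N N0 yN] := linf_bounded y.
  have [|y' Ay yy] := cy (e / (2 * M)); first by rewrite divr_gt0 ?mulr_gt0.
  have [N' N0' yN'] := linf_bounded y'.
  have [|x' Ax xx] := cx (e / (2 * N')); first by rewrite divr_gt0 ?mulr_gt0.
  exists (x' * y'); [exact: AM|move=> n].
  have -> : (x * y) n - (x' * y') n = x n * (y n - y' n) + (x n - x' n) * y' n.
    by rewrite !linfM; ring.
  apply: le_trans (le_normcD _ _) _; rewrite !normcM.
  have h1 : normc (x n) * normc (y n - y' n) <= M * (e / (2 * M)).
    by apply: ler_pM; rewrite ?normc_ge0.
  have h2 : normc (x n - x' n) * normc (y' n) <= (e / (2 * N')) * N'.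
    by apply: ler_pM; rewrite ?normc_ge0.
  have e1 : M * (e / (2 * M)) = e / 2 by field; rewrite gt_eqF.
  have e2 : e / (2 * N') * N' = e / 2 by field; rewrite gt_eqF.
  rewrite e1 in h1; rewrite e2 in h2; lra.
Qed.

Lemma closure_star A : star_closed A -> star_closed (closure A).
Proof.
move=> sA x /closureP cx; apply/closureP => e e0; have [y Ay xy] := cx e e0.
exists (linf_star y); [exact: sA|move=> n]; apply: le_trans (xy n).
by rewrite /= -rmorphB; case: (x n - y n) => a b /=; rewrite sqrrN.
Qed.

Lemma starM x y : linf_star (x * y) = linf_star x * linf_star y.
Proof. by apply: linf_eq => n; exact: (rmorphM (@conjc R)). Qed.

Lemma algspan_star S : S `<=` selfadjoint (R := R) -> star_closed (algspan S).
Proof.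
move=> Ss x; have [s0 sD sZ sM] := algspan_subalgebra S.
move: x; apply: (@algspan_min _ _ S (fun x => algspan S (linf_star x))).
- split.
  + by have -> : linf_star (0 : linf) = 0 by apply: linf_eq => n; exact: conjc0.
  + move=> x y hx hy; have -> : linf_star (x + y) = linf_star x + linf_star y.
      by apply: linf_eq => n; exact: (rmorphD (@conjc R)).
    exact: sD.
  + move=> a x hx; have -> : linf_star (a *: x) = a^* *: linf_star x.
      by apply: linf_eq => n; exact: (rmorphM (@conjc R)).
    exact: sZ.
  + by move=> x y hx hy; rewrite starM; exact: sM.
- by move=> x Sx; rewrite (Ss _ Sx); exact: sub_algspan.
Qed.

Lemma selfadjointP x : selfadjoint x <-> forall n, exists r : R, x n = r%:C.
Proof.
split=> [xs n|xr].
  move: (congr1 (fun y : linf => y n) xs) => /=; case: (x n) => a b /= [ba].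
  by exists a; have -> : b = 0 by lra.
by apply: linf_eq => n /=; have [r ->] := xr n; rewrite conjc_real.
Qed.

End LinfTheory.

(** * Periodic sequences and finite-dimensional subalgebras *)

Section FiniteValued.
Context {R : realType}.
Local Notation C := R[i].
Local Notation linf := (linf R).
Implicit Types (x y z : linf) (B S : set linf).

Lemma indicator_bounded (P : pred nat) : bounded_seq (fun n => (P n)%:R : C).
Proof. by apply: (@bounded_seq_le _ _ 1) => n; case: (P n); rewrite ?normc1 ?normc0. Qed.

Definition indicator (P : pred nat) : linf := Linf (indicator_bounded P).

Lemma interpolation (F : fieldType) (s : seq F) (f : F -> F) :
  exists p : {poly F}, forall c, c \in s -> p.[c] = f c.
Proof.
elim: s => [|c s [p ps]]; first by exists 0.
have [cs|cs] := boolP (c \in s).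
  by exists p => d; rewrite inE => /predU1P[->|]; apply: ps.
pose q := \prod_(d <- s) ('X - d%:P).
have qc : q.[c] != 0 by rewrite -/(root q c) root_prod_XsubC.
exists (p + ((f c - p.[c]) / q.[c]) *: q) => d; rewrite inE !hornerE => /predU1P[->|ds].
  by rewrite divfK // subrKC.
have /eqP -> : root q d by rewrite root_prod_XsubC.
by rewrite mulr0 addr0 ps.
Qed.

Lemma algspan_exp x k : algspan [set x] (x ^+ k.+1).
Proof.
have [_ _ _ sM] := algspan_subalgebra [set x].
have xx : algspan [set x] x by apply: sub_algspan.
by elim: k => [|k IH]; rewrite ?expr1 // exprS; apply: sM.
Qed.

(** Functional calculus for a finite-valued x: a y that is a function of x vanishing
    where x does is an interpolation polynomial in x without constant term. *)
Lemma finval_algspan x y (s : seq C) : (forall n, x n \in s) ->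
  (forall m n, x m = x n -> y m = y n) -> (forall n, x n = 0 -> y n = 0) ->
  algspan [set x] y.
Proof.
move=> xs xy x0.
pose f c := if pselect (exists n, x n = c) is left e then y (projT1 (cid e)) else 0.
have fx n : f (x n) = y n.
  by rewrite /f; case: pselect => [e|[]]; [apply/xy; case: cid|exists n].
have f0 : f 0 = 0.
  by rewrite /f; case: pselect => // e; case: cid => n /= /x0.
have [p ps] := interpolation (0 :: s) f.
have p0 : p`_0 = 0 by rewrite -horner_coef0 ps ?mem_head.
have -> : y = \sum_(i < size p) p`_i *: x ^+ i.
  apply: linf_eq => n; rewrite -fx -ps ?inE ?xs ?orbT// horner_coef linf_sum.
  by apply: eq_bigr => i _; rewrite linfZ linfX.
have [s0 _ sZ _] := algspan_subalgebra [set x].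
apply: subspace_sum => [|[[|i] ip] _] /=; first exact/subalgebra_subspace/algspan_subalgebra.
  by rewrite p0 scale0r.
exact/sZ/algspan_exp.
Qed.

(** A self-adjoint generator serves at once for both notions of generation. *)
Lemma singly_generated B x : subalgebra B -> selfadjoint x -> B x ->
  B `<=` algspan [set x] ->
  generates B [set x] /\ (closed B -> cstar_generates B [set x]).
Proof.
move=> sB xs Bx Bsub.
have xB : algspan [set x] = B.
  by apply/seteqP; split=> //; apply: algspan_min => // _ ->.
split; first by split=> //; [exists x|move=> _ ->|move=> _ _ ->].
move=> Bcl; split; [by exists x|by move=> _ ->|].
by rewrite xB -(closure_id B).1.
Qed.

(** The form in which sequences are shown not to be null: they exceed a fixed bound
    infinitely often. *)
Lemma in_linf_minus_c0 x (e : R) : 0 < e -> (forall N, exists2 n, (N <= n)%N & e < normc (x n)) ->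
  (linf_minus_c0 R `|` [set 0]) x.
Proof.
move=> e0 H; left; left=> /c0P /(_ e e0)[N Nx].
by have [n /Nx] := H N; rewrite leNgt => /negPf ->.
Qed.

Lemma periodic_genalgebrable d : (0 < d)%N ->
  genalgebrable (linf_minus_c0 R) `I_d `I_1 /\ cstar_genalgebrable (linf_minus_c0 R) `I_d `I_1.
Proof.
move=> d0; pose B := [set x : linf | forall n, x n = x (n %% d)%N].
have sB : subalgebra B.
  split=> [n|x y Bx By n|a x Bx n|x y Bx By n] //.
  - by rewrite !linfD Bx By.
  - by rewrite !linfZ Bx.
  - by rewrite !linfM Bx By.
have sM : B `<=` linf_minus_c0 R `|` [set 0].
  move=> x Bx; have [->|x0] := eqVneq x 0; first by right.
  have [n0 xn0] : exists n, x n != 0.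
    apply: contrapT => nx; move/eqP: x0; apply; apply: linf_eq => n.
    by apply: contrapT => /eqP xn; apply: nx; exists n.
  have e0 : 0 < normc (x n0) by rewrite lt_def normc_ge0 andbT; apply: contra_neq xn0 => /eq0_normc.
  apply: (@in_linf_minus_c0 _ (normc (x n0) / 2)); first by rewrite divr_gt0.
  move=> N; exists (N * d + n0)%N.
    by rewrite (leq_trans _ (leq_addr _ _)) // leq_pmulr.
  by rewrite [x (N * d + n0)%N]Bx modnMDl -Bx; lra.
have dimB : has_dim B `I_d.
  pose ind j := indicator (fun n => n %% d == j)%N.
  have indE j (n : nat) : ind j n = (n %% d == j)%N%:R by [].
  exists (ind @` `I_d); last first.
    apply: inj_card_eq => j k; rewrite !inE /= => jd kd jk.
    move: (congr1 (fun y : linf => y j) jk); rewrite !indE modn_small // eqxx.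
    by case: eqP => // _ /eqP; rewrite oner_eq0.
  split.
    apply/lin_indepP => s a us sE s0 y ys; have [j jd yj] := sE _ ys.
    move: (congr1 (fun y : linf => y j) s0); rewrite linf_sum (bigD1_seq y) // big1_seq.
      by rewrite Monoid.mulm1 linfZ -yj indE modn_small // eqxx mulr1.
    move=> z /andP[zy zs]; have [k kd zk] := sE _ zs.
    rewrite linfZ -zk indE modn_small //; case: eqP => [jk|_]; last by rewrite mulr0.
    by move/eqP: zy; case; rewrite -zk -yj jk.
  apply/seteqP; split.
    apply: linspan_min; first exact: subalgebra_subspace.
    by move=> _ [j jd <-] n; rewrite !indE modn_mod.
  move=> x Bx; have -> : x = \sum_(j < d) x j *: ind j.
    apply: linf_eq => n; rewrite linf_sum (bigD1 (Ordinal (ltn_pmod n d0))) // big1.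
      by rewrite Monoid.mulm1 linfZ indE /= eqxx mulr1 -Bx.
    move=> j /andP[_ jn]; rewrite linfZ indE; case: eqP => [nj|]; last by rewrite mulr0.
    by move/eqP: jn; case; apply: val_inj.
  apply: subspace_sum => [|j _]; first exact: linspan_subspace.
  have [_ _ sZ] := linspan_subspace (ind @` `I_d).
  by apply/sZ/sub_linspan; exists j => //=.
have gb : bounded_seq (fun n => ((n %% d).+1)%:R : C).
  apply: (@bounded_seq_le _ _ d%:R) => n.
  by rewrite -(rmorph_nat (real_complex R)) normc_real ger0_norm ?ler_nat ?ltn_pmod.
pose g : linf := Linf gb.
have gE (n : nat) : g n = ((n %% d).+1)%:R by [].
have clB : closed B.
  rewrite closure_id; apply/seteqP; split; first exact: sub_closure.
  move=> x /closureP cx n; apply/eqP; rewrite -subr_eq0; apply/eqP/eq0_normc.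
  apply: contrapT => /eqP xn; set e := normc _ in xn.
  have e0 : 0 < e by rewrite lt_def xn normc_ge0.
  have [|y By xy] := cx (e / 4); first by rewrite divr_gt0.
  have : e <= normc (x n - y n) + normc (y n - x (n %% d)%N) by apply: normc_subD.
  rewrite By normc_subC [X in _ + X]normc_subC.
  have := xy n; rewrite By normc_subC; have := xy (n %% d)%N; lra.
have [] := @singly_generated B g sB.
- by apply/selfadjointP => n; exists ((n %% d).+1)%:R; rewrite gE rmorph_nat.
- by move=> n; rewrite !gE modn_mod.
- move=> y By; apply: (@finval_algspan _ _ [seq (k.+1)%:R | k <- iota 0 d]).
  + by move=> n; rewrite gE; apply: map_f; rewrite mem_iota add0n ltn_pmod.
  + by move=> m n; rewrite !gE => /eqP; rewrite eqr_nat eqSS => /eqP mn; rewrite By mn -By.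
  + by move=> n; rewrite gE => /eqP; rewrite pnatr_eq0.
move=> gen cgen; split; exists B; split=> //.
- by split; [exists [set g] => //; apply: card_set1|move=> S [S0 _ _ _]; apply: card_ge1].
- split=> // x Bx n; rewrite /=; congr (conjc _); exact: Bx.
- split; first by exists [set g]; [exact: cgen|apply: card_set1].
  by move=> S [S0 _ _]; apply: card_ge1.
Qed.

(** The numbers x n are eigenvalues of the matrix of multiplication by x, because the
    values at n of a basis form an eigenvector; when this vector is zero,
    so is x n. *)
Lemma findim_finval B d x : subalgebra B -> has_dim B `I_d -> B x ->
  exists s : seq C, forall n, x n \in s.
Proof.
move=> [_ _ _ BM] [E [_ EB] Ed] Bx.
have /finite_seqP[s sE] : finite_set E by exists d.
pose e := tnth (in_tuple s).
have coords z : B z -> exists a : 'I_(size s) -> C, z = \sum_j a j *: e j.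
  rewrite -EB sE; move: z; apply: linspan_min; last first.
    move=> z /= zs; have zi : (index z s < size s)%N by rewrite index_mem.
    exists (fun j => (j == Ordinal zi)%:R); rewrite (bigD1 (Ordinal zi)) //= big1 ?addr0.
      by rewrite eqxx scale1r /e (tnth_nth z) /= nth_index.
    by move=> j /negPf ->; rewrite scale0r.
  split.
  - by exists (fun=> 0); rewrite big1 // => j _; rewrite scale0r.
  - move=> _ _ [a ->] [b ->]; exists (fun j => a j + b j).
    by rewrite -big_split /=; apply: eq_bigr => j _; rewrite scalerDl.
  - move=> c _ [a ->]; exists (fun j => c * a j).
    by rewrite scaler_sumr; apply: eq_bigr => j _; rewrite scalerA.
have Be j : B (e j) by rewrite -EB; apply: sub_linspan; rewrite sE /=; apply: mem_tnth.
have [A AE] := choice (fun i => coords _ (BM _ _ Bx (Be i))).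
pose M := (\matrix_(i, j) A i j)^T.
have [r rE] := closed_field_poly_normal (char_poly M).
exists (0 :: r) => n; rewrite inE; case: eqVneq => //= xn.
have [a xa] := coords _ Bx.
suff : eigenvalue M (x n).
  by rewrite eigenvalue_root_char rE (monicP (char_poly_monic M)) scale1r root_prod_XsubC.
apply/eigenvalueP; exists (\row_j e j n).
  apply/rowP => i; rewrite !mxE; transitivity ((x * e i) n); last by rewrite linfM.
  rewrite AE linf_sum; apply: eq_bigr => j _.
  by rewrite !mxE linfZ mulrC.
apply: contra_neq xn => v0; rewrite xa linf_sum big1 // => j _.
by rewrite linfZ; move/rowP/(_ j): v0; rewrite !mxE => ->; rewrite mulr0.
Qed.

(** The level sets of the elements of a basis give finitely many idempotents
    L of B that span B.  Combining them as binary digits gives an x of which all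
    of them are functions. *)
Lemma findim_singly_generated B d : subalgebra B -> has_dim B `I_d ->
  exists x, [/\ selfadjoint x, B x & B `<=` algspan [set x]].
Proof.
move=> sB dB; have [B0 BD BZ BM] := sB.
have [E [_ EB] Ed] := dB.
have /finite_seqP[s sE] : finite_set E by exists d.
have [L LB sL] : exists2 L : seq linf,
    (forall y, y \in L -> B y /\ exists b : nat -> bool, forall n, y n = (b n)%:R) &
    (forall y, y \in s -> linspan [set` L] y).
  have : forall y, y \in s -> B y by move=> y ys; rewrite -EB; apply: sub_linspan; rewrite sE.
  elim: {sE} s => [|y s IH] sB'; first by exists [::].
  have [|L LB sL] := IH; first by move=> z zs; apply: sB'; rewrite inE zs orbT.
  have By := sB' _ (mem_head _ _).
  have [r yr] := findim_finval sB dB By.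
  pose r' := [seq c <- undup r | c != 0].
  pose L' := [seq indicator (fun n => y n == c) | c <- r'].
  have mono (L1 : seq linf) (z : linf) : {subset L1 <= L' ++ L} -> linspan [set` L1] z ->
    linspan [set` L' ++ L] z by move=> sub; apply: linspan_mono.
  exists (L' ++ L).
    move=> z; rewrite mem_cat => /orP[/mapP[c]|/LB//].
    rewrite mem_filter => /andP[c0 _ ->]; split; last by eexists.
    have /algspan_min : [set y] `<=` B by move=> _ ->.
    move=> /(_ sB); apply; apply: (finval_algspan yr) => [m n /= ->//|n /= ->].
    by rewrite eq_sym (negPf c0).
  move=> z; rewrite inE => /predU1P[->{z}|/sL]; last first.
    by apply: mono => u; rewrite mem_cat orbC => ->.
  apply: (mono L'); first by move=> u; rewrite mem_cat => ->.
  have -> : y = \sum_(c <- r') c *: indicator (fun n => y n == c).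
    apply: linf_eq => n; rewrite linf_sum.
    have [yn0|yn] := eqVneq (y n) 0.
      rewrite yn0 big1_seq // => c; rewrite mem_filter => /andP[_ /andP[c0 _]].
      by rewrite linfZ /= yn0 eq_sym (negPf c0) mulr0.
    rewrite (bigD1_seq (y n)) ?filter_uniq ?undup_uniq ?mem_filter ?yn ?mem_undup ?yr//.
    rewrite big1 ?Monoid.mulm1; first by rewrite linfZ /= eqxx mulr1.
    by move=> c cy; rewrite linfZ /= eq_sym (negPf cy) mulr0.
  rewrite big_seq; apply: subspace_sum => [|c cr]; first exact: linspan_subspace.
  have [_ _ sZ] := linspan_subspace [set` L'].
  by apply/sZ/sub_linspan/map_f.
have [x Bx [[k [N kN] xk] xL]] : exists2 x, B x &
    (exists2 k : nat -> nat, exists N, forall n, (k n < N)%N & forall n, x n = (k n)%:R) /\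
    (forall y, y \in L -> algspan [set x] y).
  elim: {sL} L LB => [|y L IH] LB.
    by exists 0 => //; split=> //; exists (fun=> 0%N) => //; exists 1%N.
  have [|x Bx [[k [N kN] xk] xL]] := IH; first by move=> z zL; apply: LB; rewrite inE zL orbT.
  have [By [b yb]] := LB _ (mem_head _ _).
  (* The digit y is the parity of z, and x the integer part of its half. *)
  pose z := y + 2%:R *: x.
  have zE n : z n = (b n + (k n).*2)%:R.
    by rewrite linfD linfZ yb xk -muln2 natrD natrM [(k n)%:R * _]mulrC.
  have zs n : z n \in [seq j%:R | j <- iota 0 (1 + N.*2)].
    rewrite zE map_f // mem_iota add0n /=; have := kN n; case: (b n) => /=; lia.
  have zinj m n : z m = z n -> b m = b n /\ k m = k n.
    rewrite !zE => /eqP; rewrite eqr_nat => /eqP; case: (b m); case: (b n) => /=; lia.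
  have z0 n : z n = 0 -> b n = false /\ k n = 0%N.
    rewrite zE => /eqP; rewrite pnatr_eq0; case: (b n) => //=; lia.
  exists z; first by apply: BD => //; apply: BZ.
  split.
    exists (fun n => (b n + (k n).*2)%N) => //; exists (1 + N.*2)%N => n.
    by have := kN n; case: (b n) => /=; lia.
  have zx : algspan [set z] x.
    apply: (finval_algspan zs) => [m n /zinj[_ kmn]|n /z0[_ kn]]; rewrite !xk ?kmn ?kn//.
  move=> u; rewrite inE => /predU1P[->|/xL].
    by apply: (finval_algspan zs) => [m n /zinj[bmn _]|n /z0[bn _]]; rewrite !yb ?bmn ?bn.
  by apply: algspan_min; [apply: algspan_subalgebra|move=> _ ->].
exists x; split=> //.
  by apply/selfadjointP => n; exists (k n)%:R; rewrite xk rmorph_nat.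
rewrite -EB sE; apply: linspan_min; first exact/subalgebra_subspace/algspan_subalgebra.
move=> y /sL; apply: linspan_min; first exact/subalgebra_subspace/algspan_subalgebra.
by move=> z /xL.
Qed.

Lemma findim_not_genalgebrable (M : set linf) d n : n <> 1%N ->
  ~ genalgebrable M `I_d `I_n /\ ~ cstar_genalgebrable M `I_d `I_n.
Proof.
move=> n1.
have no (P : set (set linf)) x : (forall S, P S -> S !=set0) -> P [set x] -> ~ least_card P `I_n.
  move=> P0 Px [[S PS Sn] H]; apply: n1; apply/eqP; rewrite eqn_leq; apply/andP; split.
    by rewrite -card_le_II (card_le_trans (H _ Px))// card_eqW // card_set1.
  by rewrite -card_le_II (card_le_trans (card_ge1 (P0 _ PS))) // card_eqW.
split=> [[B [sB _ dB lc]]|[B [[sB _ clB] _ dB lc]]].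
  have [x [xs Bx Bsub]] := findim_singly_generated sB dB.
  have [gen _] := singly_generated sB xs Bx Bsub.
  by apply: no lc => [S [] //|]; exact: gen.
have [x [xs Bx Bsub]] := findim_singly_generated sB dB.
have [_ gen] := singly_generated sB xs Bx Bsub.
by apply: no lc => [S [] //|]; exact: gen.
Qed.

End FiniteValued.

(** * A large independent family of coordinates *)

Section Coordinates.
Context {R : realType}.
Local Notation C := R[i].
Local Notation linf := (linf R).
Implicit Types (x y z : linf) (B S : set linf).

(** The first component of the pair is free, so that every value recurs infinitely often. *)
Definition decode (T : countType) (y0 : T) (m : nat) : T :=
  if @choice.unpickle (nat * T)%type m is Some p then p.2 else y0.

Lemma decode_often (T : countType) (y0 y : T) N : exists2 m, (N <= m)%N & decode y0 m = y.
Proof.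
have inj : injective (fun j : nat => choice.pickle (j, y)).
  by move=> i j /(pcan_inj choice.pickleK)[].
have [j Nj] := injective_gtn inj N.
exists (choice.pickle (j, y)); first exact: ltnW.
by rewrite /decode choice.pickleK.
Qed.

Definition prefix_of k (t : set nat) : seq bool := [seq `[< t i >] | i <- iota 0 k].

Lemma prefix_of_le k k' t : (k <= k')%N -> prefix_of k t = take k (prefix_of k' t).
Proof. by move=> kk; rewrite /prefix_of -map_take take_iota (minn_idPl kk). Qed.

(** Finitely many subsets of nat are told apart by long enough initial segments. *)
Lemma prefix_sep (T : seq (set nat)) : exists k, forall t u, t \in T -> u \in T ->
  prefix_of k t = prefix_of k u -> t = u.
Proof.
have ex (p : set nat * set nat) : exists k, prefix_of k p.1 = prefix_of k p.2 -> p.1 = p.2.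
  have [->|/eqP ne] := eqVneq p.1 p.2; first by exists 0%N.
  have [i ti] : exists i, ~ (p.1 i <-> p.2 i).
    by apply: contrapT => H; apply: ne; apply/seteqP; split=> i; apply: contrapT => h;
       apply: H; exists i => h'; apply: h; apply h'.
  exists i.+1 => /(congr1 (fun s => nth false s i)).
  rewrite !(nth_map 0%N) ?size_iota ?nth_iota// add0n => eqi.
  exfalso; exact: ti (asbool_eq_equiv eqi).
have [k kP] := choice ex.
exists (\max_(p <- [seq (t, u) | t <- T, u <- T]) k p)%N => t u tT uT tu.
apply: (kP (t, u)) => /=.
have le : (k (t, u) <= \max_(p <- [seq (t, u) | t <- T, u <- T]) k p)%N.
  by apply: (leq_bigmax_seq (t, u)) => //; apply: allpairs_f.
by rewrite !(prefix_of_le _ le) tu.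
Qed.

(** Truncating the numerator keeps the value in the unit interval; a zero denominator
    gives 0. *)
Definition frac (p : nat * nat) : R := (minn p.1 p.2)%:R / p.2%:R.

Lemma frac_itv p : 0 <= frac p <= 1.
Proof.
rewrite /frac; case: p => a [|b] /=; first by rewrite invr0 mulr0 lexx ler01.
rewrite divr_ge0 //= ler_pdivrMr ?ltr0n// mul1r ler_nat; exact: geq_minr.
Qed.

Lemma frac0 : frac (0%N, 0%N) = 0.
Proof. by rewrite /frac invr0 mulr0. Qed.

Definition lookup (l : seq (seq bool * (nat * nat))) (b : seq bool) : nat * nat :=
  (head ([::], (0%N, 0%N)) [seq p <- l | p.1 == b]).2.

(** An index encodes a length k and a finite table that assigns fractions to some
    0-1 words of length k.  The coordinate t reads off the entry of its own word,
    so that coordinates with distinct words take independent values. *)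
Definition coordR (t : set nat) (m : nat) : R :=
  let c := decode (0%N, [::] : seq (seq bool * (nat * nat))) m in
  frac (lookup c.2 (prefix_of c.1 t)).

Lemma coordR_itv t m : 0 <= coordR t m <= 1.
Proof. exact: frac_itv. Qed.

Lemma coord_bounded t : bounded_seq (fun m => (coordR t m)%:C).
Proof.
apply: (@bounded_seq_le _ _ 1) => m; rewrite normc_real.
by have /andP[h0 h1] := coordR_itv t m; rewrite ger0_norm.
Qed.

Definition coord t : linf := Linf (coord_bounded t).

Lemma coordE t m : coord t m = (coordR t m)%:C. Proof. by []. Qed.

(** The table listing the prescribed values at the words of the members of T, which a
    suitable k separates, is encoded by infinitely many indices. *)
Lemma coord_hit (T : seq (set nat)) (v : set nat -> nat * nat) N :
  exists2 m, (N <= m)%N & forall t, t \in T -> coordR t m = frac (v t).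
Proof.
have [k kP] := prefix_sep T.
have [m Nm dm] := decode_often (0%N, [::] : seq (seq bool * (nat * nat)))
  (k, [seq (prefix_of k t, v t) | t <- T]) N.
exists m => // t tT; rewrite /coordR dm /= /lookup; congr frac.
set l := [seq p <- _ | _].
have tl : (prefix_of k t, v t) \in l by rewrite mem_filter eqxx /=; apply: map_f.
have : head ([::], (0%N, 0%N)) l \in l by case: l tl => // p l _; apply: mem_head.
rewrite {2}/l mem_filter => /andP[/eqP pt /mapP[u uT hu]].
by rewrite hu /= in pt *; rewrite (kP u t).
Qed.

Lemma coord_inj : injective coord.
Proof.
move=> t u tu; apply: contrapT => ne.
have [m _ mP] := coord_hit [:: t; u] (fun w => if w == t then (1, 1)%N else (0, 0)%N) 0.
have /(congr1 (fun x : linf => complex.Re (x m))) := tu.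
rewrite !coordE /= !mP ?inE ?eqxx ?orbT//.
case: eqP => [ut|_]; first by case: ne.
by rewrite frac0 /frac divr1 => /eqP; rewrite oner_eq0.
Qed.

Lemma coord_selfadjoint t : selfadjoint (coord t).
Proof. by apply/selfadjointP => m; exists (coordR t m). Qed.

(** The uniform control of polynomials in the elements of S by the elements themselves;
    a quantitative form of continuity. *)
Definition lipschitz_wrt S y := exists2 L : R, 0 < L & forall m n (d : R), 0 <= d ->
  (forall f, S f -> normc (f m - f n) <= d) -> normc (y m - y n) <= L * d.

Lemma algspan_lipschitz S y : algspan S y -> lipschitz_wrt S y.
Proof.
move: y; apply: (@algspan_min _ _ S (lipschitz_wrt S)).
- split.
  + exists 1 => // m n d d0 _; rewrite !linf0 subrr normc0; lra.
  + move=> x y [L L0 Lx] [K K0 Ky]; exists (L + K) => [|m n d d0 H]; first lra.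
    have -> : (x + y) m - (x + y) n = (x m - x n) + (y m - y n) by rewrite !linfD; ring.
    apply: le_trans (le_normcD _ _) _.
    have := Lx _ _ _ d0 H; have := Ky _ _ _ d0 H; lra.
  + move=> a x [L L0 Lx]; exists ((normc a + 1) * L) => [|m n d d0 H].
      by rewrite mulr_gt0 // ltr_wpDl ?normc_ge0.
    rewrite !linfZ -mulrBr normcM -mulrA; apply: ler_pM; rewrite ?normc_ge0 ?lerDl//.
    exact: Lx.
  + move=> x y [L L0 Lx] [K K0 Ky].
    have [M M0 xM] := linf_bounded x; have [N N0 yN] := linf_bounded y.
    exists (M * K + L * N) => [|m n d d0 H]; first by rewrite addr_gt0 ?mulr_gt0.
    have -> : (x * y) m - (x * y) n = x m * (y m - y n) + (x m - x n) * y n.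
      by rewrite !linfM; ring.
    apply: le_trans (le_normcD _ _) _; rewrite !normcM mulrDl; apply: lerD.
      by rewrite -mulrA; apply: ler_pM; rewrite ?normc_ge0//; exact: Ky.
    by rewrite mulrAC; apply: ler_pM; rewrite ?normc_ge0//; exact: Lx.
- by move=> f Sf; exists 1 => // m n d d0 H; rewrite mul1r; apply: H.
Qed.

Lemma uniform_lipschitz (I : finType) (S : set linf) (g : I -> linf) :
  (forall i, lipschitz_wrt S (g i)) -> exists2 L : R, 0 < L & forall i m n (d : R), 0 <= d ->
  (forall f, S f -> normc (f m - f n) <= d) -> normc (g i m - g i n) <= L * d.
Proof.
move=> gL.
have ex i : exists L : R, 0 < L /\ forall m n (d : R), 0 <= d ->
  (forall f, S f -> normc (f m - f n) <= d) -> normc (g i m - g i n) <= L * d.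
  by have [L L0 LP] := gL i; exists L.
have [L LP] := choice ex.
exists (1 + \sum_i L i) => [|i m n d d0 H].
  by rewrite ltr_pwDl // sumr_ge0 // => i _; apply: ltW; have [] := LP i.
apply: le_trans ((LP i).2 m n d d0 H) _; apply: ler_wpM2r => //.
rewrite (bigD1 i) //= addrCA lerDl addr_ge0 // sumr_ge0 // => j _.
by apply: ltW; have [] := LP j.
Qed.

Lemma Re_normc (z : C) : `|complex.Re z| <= normc z.
Proof.
by case: z => a b /=; rewrite -sqrtr_sqr ler_wsqrtr // lerDl sqr_ge0.
Qed.

Lemma algspan_coord_sub (K : set (set nat)) y : algspan (coord @` K) y ->
  exists2 T : seq (set nat), (forall t, t \in T -> K t) & algspan (coord @` [set` T]) y.
Proof.
move=> /algspan_fin[s sr sy]; have [T TK sE] := seq_image sr; exists T => //.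
apply: algspan_mono sy => z /=; rewrite sE => /mapP[t tT ->].
by exists t.
Qed.

Lemma algspan_coord_agree (T : seq (set nat)) y m n : algspan (coord @` [set` T]) y ->
  (forall t, t \in T -> coordR t m = coordR t n) -> y m = y n.
Proof.
move=> /algspan_lipschitz[L _ yL] mn; apply/eqP; rewrite -subr_eq0; apply/eqP/eq0_normc.
apply/le_anti; rewrite normc_ge0 andbT -(mulr0 L); apply: yL => // _ [t tT <-].
by rewrite !coordE mn // subrr normc0.
Qed.

End Coordinates.

(** * Finitely many generators control as many coordinates *)

Section Dimension.
Context {R : realType}.
Local Notation C := R[i].
Local Notation linf := (linf R).
Local Notation coord := (@coord R).
Local Notation coordR := (@coordR R).
Local Notation Re := complex.Re.
Implicit Types (x y z : linf) (B S : set linf).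

Lemma ReB (a b : C) : Re (a - b) = Re a - Re b.
Proof. by case: a b => ? ? []. Qed.

Lemma Re_dist (a b : C) : `|Re a - Re b| <= normc (a - b).
Proof. by rewrite -ReB Re_normc. Qed.

Lemma unit_step_frac d N (v : {ffun 'I_d -> 'I_N.+1}) (A : {set 'I_d}) (i : 'I_d) :
  (0 < N)%N -> (forall j, v j != ord_max) ->
  `|@frac R (nat_of_ord ((v + \sum_(j in A) unit_step N j)%R i), N) - @frac R (nat_of_ord (v i), N)| <= N%:R^-1.
Proof.
move=> N0 vN; have [iA|iA] := boolP (i \in A); last first.
  by rewrite sum_step_out // subrr normr0 invr_ge0 ler0n.
rewrite sum_step_in // /frac /=.
have lt : (v i < N)%N by rewrite ltn_neqAle vN -ltnS ltn_ord.
rewrite (minn_idPl lt) (minn_idPl (ltnW lt)) -mulrBl -natrB ?leqnSn//.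
by rewrite subSnn mul1r ger0_norm // invr_ge0 ler0n.
Qed.

(** Discrete Poincare-Miranda.  At the points m v, where the given coordinates take the
    values v / N and all other relevant ones vanish, g i is close to v i / N, hence
    below y i on one side of the grid and above it on the other.  On a cube given
    by Kuhn's lemma g i passes through y i, and by the Lipschitz property it varies
    little. *)
Lemma approx_onto d (t : 'I_d -> set nat) (g : 'I_d -> linf) :
  injective t -> (forall i, closure (algspan (range coord)) (g i)) ->
  (forall i m, normc (coord (t i) m - g i m) <= 8^-1) ->
  forall (y : 'I_d -> R) (eta : R), (forall i, 4^-1 <= y i <= 3 / 4) -> 0 < eta ->
  exists m, forall i, `|Re (g i m) - y i| <= eta.
Proof.
move=> tinj gcl gt y eta y14 eta0.
(* The bound eta / 2 serves the final estimate.  The bound 1/16 keeps 1/8 + e, the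
   distance from the coordinates to their approximations, below 1/4. *)
pose e := Num.min (eta / 2) (16^-1).
have e0 : 0 < e by rewrite lt_min; apply/andP; split; lra.
have e16 : e <= 16^-1 by rewrite ge_min lexx orbT.
have e2 : e <= eta / 2 by rewrite ge_min lexx.
have ex i : exists p, algspan (range coord) p /\ forall n, normc (g i n - p n) <= e.
  by have /closureP/(_ e e0)[p pa pg] := gcl i; exists p.
have [p pP] := choice ex.
have exT i : exists T : seq (set nat), algspan (coord @` [set` T]) (p i).
  by have [T0 _] := algspan_coord_sub (pP i).1; exists T0.
have [T0 T0P] := choice exT.
pose T := codom t ++ flatten [seq T0 i | i <- enum 'I_d].
have pT i : lipschitz_wrt (coord @` [set` T]) (p i).
  apply: algspan_lipschitz; apply: algspan_mono (T0P i) => _ [u /= uT <-].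
  exists u => //=; rewrite mem_cat; apply/orP; right; apply/flattenP.
  by exists (T0 i) => //; apply: map_f; rewrite mem_enum.
have [L L0 LP] := uniform_lipschitz pT.
pose N := (Num.trunc (L / e)).+1.
have LN : L * N%:R^-1 <= e.
  rewrite ler_pdivrMr ?ltr0n// mulrC -ler_pdivrMr//.
  by apply: ltW; apply: truncnS_gt.
pose val (v : {ffun 'I_d -> 'I_N.+1}) (u : set nat) :=
  if [pick i | t i == u] is Some i then (nat_of_ord (v i), N) else (0, 0)%N.
have valt v i : val v (t i) = (nat_of_ord (v i), N).
  by rewrite /val; case: pickP => [j /eqP/tinj ->//|/(_ i)]; rewrite eqxx.
have exm v : exists m, forall u, u \in T -> coordR u m = @frac R (val v u).
  by have [m _ mP] := coord_hit (R := R) T (val v) 0; exists m.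
have [m mP] := choice exm.
have tT i : t i \in T by rewrite mem_cat codom_f.
have pclose i (v : {ffun 'I_d -> 'I_N.+1}) : `|@frac R (nat_of_ord (v i), N) - Re (p i (m v))| <= 8^-1 + e.
  rewrite -valt -(mP v _ (tT i)) -[coordR _ _]/(Re (coord (t i) (m v))).
  apply: le_trans (Re_dist _ _) _; apply: le_trans (normc_subD (g i (m v)) _ _) _.
  by apply: lerD => //; exact: (pP i).2.
pose h i (v : {ffun 'I_d -> 'I_N.+1}) : 'F_2 := if y i < Re (p i (m v)) then 1 else 0.
have [||v vN vh] := @kuhn_lemma d N h.
- move=> i v vi; rewrite /h; case: ltP => // ylt; exfalso.
  have := pclose i v; have /andP[yi _] := y14 i.
  by rewrite vi /frac min0n mul0r sub0r normrN => /ler_normlP[_]; lra.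
- move=> i v vi; rewrite /h; case: ltP => // ylt; exfalso.
  have := pclose i v; have /andP[_ yi] := y14 i.
  by rewrite vi /frac /= minnn divff ?pnatr_eq0// => /ler_normlP[_]; lra.
exists (m v) => i.
have near (A : {set 'I_d}) : `|Re (p i (m (v + \sum_(j in A) unit_step N j))) - Re (p i (m v))| <= e.
  apply: le_trans (Re_dist _ _) _; apply: le_trans LN.
  apply: LP; first by rewrite invr_ge0 ler0n.
  move=> _ [u /= uT <-]; rewrite !coordE -rmorphB normc_real !mP //.
  rewrite /val; case: pickP => [j _|_]; first exact: unit_step_frac.
  by rewrite subrr normr0 invr_ge0 ler0n.
have py : `|Re (p i (m v)) - y i| <= e.
  have [A [B]] := vh i; rewrite /h.
  have /ler_normlP[a1 a2] := near A; have /ler_normlP[b1 b2] := near B.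
  by case: ltP => hA; case: ltP => hB; rewrite ?eqxx// => _; apply/ler_normlP; split; lra.
have := le_trans (Re_dist (g i (m v)) (p i (m v))) ((pP i).2 (m v)).
move: py => /ler_normlP[a1 a2] /ler_normlP[b1 b2]; apply/ler_normlP; split; lra.
Qed.

(** Comparison of M ^ n.+1 grid points y k, approximately attained by g at m k, with
    (c0 * M) ^ n boxes for the values of f.  Since g is Lipschitz in f, points in
    the same box have values of g too close for distinct grid points; thus
    M ^ n.+1 <= (c0 * M) ^ n, which fails for M > c0 ^ n. *)
Lemma coord_dimension n (t : 'I_n.+1 -> set nat) (f : 'I_n -> linf) :
  injective t -> (forall j, selfadjoint (f j)) ->
  (forall j, closure (algspan (range coord)) (f j)) ->
  ~ (forall i, closure (algspan (range f)) (coord (t i))).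
Proof.
move=> tinj fsa fcl tcl.
have ex i : exists g, algspan (range f) g /\ forall m, normc (coord (t i) m - g m) <= 8^-1.
  by have /closureP/(_ 8^-1)[|g ga gt] := tcl i; [lra|exists g].
have [g gP] := choice ex.
have [L0 L0_gt0 L0P] := uniform_lipschitz (fun i => algspan_lipschitz (gP i).1).
pose L := (Num.trunc L0).+1.
have LL : L0 <= L%:R by apply/ltW/truncnS_gt.
have exC j : exists c : nat, forall m, normc (f j m) <= c%:R.
  have [M M0 fM] := linf_bounded (f j); exists (Num.trunc M).+1 => m.
  by apply: le_trans (fM m) _; apply/ltW/truncnS_gt.
have [c cP] := choice exC.
pose D := (\sum_j c j).+1.
have fD j m : `|Re (f j m)| <= D%:R.
  apply: le_trans (Re_normc _) _; apply: le_trans (cP j m) _.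
  by rewrite ler_nat /D (bigD1 j) //= -addnS leq_addr.
pose c0 := (16 * D * L).+1.
pose M := (c0 ^ n).+1.
have M0 : 0 < M%:R :> R by rewrite ltr0n.
(* A grid in the cube [1/4, 3/4]^(n+1) of mesh 1/(2M). *)
pose y (k : {ffun 'I_n.+1 -> 'I_M}) i : R := 4^-1 + (k i)%:R / (2 * M%:R).
have exm (k : {ffun 'I_n.+1 -> 'I_M}) : exists m, forall i, `|Re (g i m) - y k i| <= (8 * M%:R)^-1.
  apply: approx_onto tinj _ _ _ _ _ _.
  - move=> i; have sc := closure_subalgebra (algspan_subalgebra (range coord)).
    move: (gP i).1; apply: algspan_min => // _ [j _ <-]; exact: fcl.
  - by move=> i; exact: (gP i).2.
  - move=> i; rewrite /y; have := ltn_ord (k i); rewrite -(ltr_nat R) => kM.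
    have : 0 <= (k i)%:R / (2 * M%:R) :> R by rewrite divr_ge0 ?mulr_ge0 ?ler0n.
    have : (k i)%:R / (2 * M%:R) <= 2^-1 :> R.
      by rewrite ler_pdivrMr ?mulr_gt0//; lra.
    lra.
  - by rewrite invr_gt0 mulr_gt0.
have [m mP] := choice exm.
pose Q := (c0 * M)%N.
(* Integer parts of z number the boxes, whose side 1/(8LM) the Lipschitz constant L
   turns into 1/(8M).  With the two errors 1/(8M) of approximation this stays below
   the mesh. *)
pose z k j : R := (Re (f j (m k)) + D%:R) * (8 * L * M)%:R.
have z0 k j : 0 <= z k j.
  by apply: mulr_ge0; [have /ler_normlP[] := fD j (m k); lra|rewrite ler0n].
have zQ k j : (Num.trunc (z k j) < Q)%N.
  rewrite truncn_lt_nat //; apply: (@le_lt_trans _ _ ((2 * D * (8 * L * M))%:R)).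
    rewrite /z [in leRHS]natrM; apply: ler_wpM2r; first by rewrite ler0n.
    by rewrite natrM; have /ler_normlP[] := fD j (m k); lra.
  by rewrite ltr_nat /Q /c0; nia.
pose b k : {ffun 'I_n -> 'I_Q} := [ffun j => Ordinal (zQ k j)].
have binj : injective b.
  move=> k k' bkk; apply/ffunP => i; apply: contrapT => /eqP ne.
  have fclose j : normc (f j (m k) - f j (m k')) <= (8 * L * M)%:R^-1.
    have := congr1 (fun b : {ffun 'I_n -> 'I_Q} => nat_of_ord (b j)) bkk.
    rewrite !ffunE /= => tt.
    have /andP[l1 l2] := truncn_itv (z0 k j); have /andP[r1 r2] := truncn_itv (z0 k' j).
    rewrite tt in l1 l2.
    have [r rE] := (selfadjointP _).1 (fsa j) (m k).
    have [s sE] := (selfadjointP _).1 (fsa j) (m k').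
    rewrite rE sE -rmorphB normc_real -[leRHS]mul1r ler_pdivlMr ?ltr0n//.
    have -> : `|r - s| * (8 * L * M)%:R = `|z k j - z k' j|.
      rewrite -[in LHS](ger0_norm (ler0n R (8 * L * M))) -normrM; congr (`|_|).
      by rewrite /z rE sE /=; ring.
    rewrite -natr1 in l2; rewrite -natr1 in r2.
    by apply/ler_normlP; split; lra.
  have gclose : normc (g i (m k) - g i (m k')) <= L0 * (8 * L * M)%:R^-1.
    apply: L0P; first by rewrite invr_ge0 ler0n.
    by move=> _ [j _ <-]; exact: fclose.
  have gl : L0 * (8 * L * M)%:R^-1 <= (8 * M%:R)^-1.
    rewrite ler_pdivrMr ?ltr0n// !natrM.
    have -> : (8 * M%:R)^-1 * (8%:R * L%:R * M%:R) = L%:R :> R by field; rewrite gt_eqF.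
    by [].
  have := le_trans (Re_dist _ _) (le_trans gclose gl).
  have := mP k i; have := mP k' i; rewrite /y.
  have i2 : (k i)%:R / (2 * M%:R) = 4 * (k i)%:R * (8 * M%:R)^-1 :> R by field; rewrite gt_eqF.
  have i2' : (k' i)%:R / (2 * M%:R) = 4 * (k' i)%:R * (8 * M%:R)^-1 :> R by field; rewrite gt_eqF.
  have w0 : 0 < (8 * M%:R)^-1 :> R by rewrite invr_gt0 mulr_gt0.
  rewrite i2 i2'; set w := (8 * M%:R)^-1 in w0 *.
  move=> /ler_normlP[a1 a2] /ler_normlP[b1 b2] /ler_normlP[c1 c2].
  have [lt|gt|eq] := ltngtP (k i) (k' i).
  - have : (k i)%:R + 1 <= (k' i)%:R :> R by rewrite natr1 ler_nat.
    move=> h; have : ((k i)%:R + 1) * w <= (k' i)%:R * w by rewrite ler_wpM2r // ltW.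
    lra.
  - have : (k' i)%:R + 1 <= (k i)%:R :> R by rewrite natr1 ler_nat.
    move=> h; have : ((k' i)%:R + 1) * w <= (k i)%:R * w by rewrite ler_wpM2r // ltW.
    lra.
  - by move/eqP: ne; apply; apply: val_inj.
have := leq_card b binj; rewrite !card_ffun !card_ord /Q expnMn expnS.
rewrite leq_pmul2r ?expn_gt0//; by rewrite /M ltnn.
Qed.

End Dimension.

(** * The continuum inside the reals *)

Section CantorReal.
Variable R : realType.
Implicit Types t u : set nat.

(** Partial sums of the ternary expansion with digits 0 and 1 that describes t. *)
Definition ternary_sum t n : R := \sum_(k < n) (if `[< t k >] then 3 ^- k.+1 else 0).

Lemma ternary_sumS t n : ternary_sum t n.+1 = ternary_sum t n + (if `[< t n >] then 3 ^- n.+1 else 0).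
Proof. by rewrite /ternary_sum big_ord_recr. Qed.

(** The tail after k digits is at most half of the k-th power of 1/3, which makes
    expansions with digits 0 and 1 unique. *)
Lemma ternary_sum_le t k n : (k <= n)%N -> ternary_sum t n <= ternary_sum t k + (3 ^- k - 3 ^- n) / 2.
Proof.
move=> /subnK <-; elim: (n - k)%N => [|m IH]; first by rewrite add0n subrr mul0r addr0.
rewrite addSn ternary_sumS.
have e : 3 ^- (m + k) = 3 * 3 ^- (m + k).+1 :> R by rewrite [in RHS]exprS; field; rewrite expf_neq0.
have : 0 <= 3 ^- (m + k).+1 :> R by rewrite invr_ge0 exprn_ge0.
by move: IH; rewrite e; case: ifP => _; lra.
Qed.

Lemma ternary_sum_ge t k n : (k <= n)%N -> ternary_sum t k <= ternary_sum t n.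
Proof.
move=> /subnK <-; elim: (n - k)%N => [//|m IH]; rewrite addSn ternary_sumS.
by apply: le_trans IH _; rewrite lerDl; case: ifP => // _; rewrite invr_ge0 exprn_ge0.
Qed.

Definition cantor_real t : R := sup (range (ternary_sum t)).

Lemma ternary_sum_ub t : has_ubound (range (ternary_sum t)).
Proof.
exists (2^-1) => _ [n _ <-]; have := ternary_sum_le t (leq0n n).
rewrite /ternary_sum big_ord0 expr0 invr1; have : 0 <= 3 ^- n :> R by rewrite invr_ge0 exprn_ge0.
lra.
Qed.

Lemma ternary_cantor t n : ternary_sum t n <= cantor_real t.
Proof. by apply: ub_le_sup; [exact: ternary_sum_ub|exists n]. Qed.

Lemma cantor_real_ternary t k : cantor_real t <= ternary_sum t k + 3 ^- k / 2.
Proof.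
apply: ge_sup; first by exists (ternary_sum t 0), 0%N.
move=> _ [n _ <-]; have h j : 0 <= 3 ^- j :> R by rewrite invr_ge0 exprn_ge0.
have [/(ternary_sum_le t)|/ltnW/(ternary_sum_ge t)] := leqP k n.
  have := h n; lra.
have := h k; lra.
Qed.

Lemma cantor_real_itv t : 0 <= cantor_real t <= 2^-1.
Proof.
have := ternary_cantor t 0; have := cantor_real_ternary t 0.
by rewrite /ternary_sum !big_ord0 expr0 => h1 h2; apply/andP; split; lra.
Qed.

Lemma cantor_real_lt t u k : (forall i, (i < k)%N -> t i <-> u i) -> u k -> ~ t k ->
  cantor_real t < cantor_real u.
Proof.
move=> tu uk tk.
have e : ternary_sum t k = ternary_sum u k.
  by apply: eq_bigr => i _; rewrite (asbool_equiv_eq (tu _ (ltn_ord i))).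
have := ternary_cantor u k.+1; have := cantor_real_ternary t k.+1.
rewrite !ternary_sumS e (asboolT uk) (asboolF tk).
have : 0 < 3 ^- k.+1 :> R by rewrite invr_gt0 exprn_gt0.
lra.
Qed.

Lemma cantor_real_inj : injective cantor_real.
Proof.
move=> t u tu; apply: contrapT => ne.
have ex : exists i, `[< ~ (t i <-> u i) >].
  apply: contrapT => H; apply: ne; apply/seteqP.
  by split=> i h; apply: contrapT => h'; apply: H; exists i; apply/asboolP => -[a b]; auto.
case: (ex_minnP ex) => k /asboolP kP kmin.
have eqb i : (i < k)%N -> t i <-> u i.
  move=> ik; apply: contrapT => /asboolP/kmin; by rewrite leqNgt ik.
have [tk|tk] := pselect (t k); have [uk|uk] := pselect (u k).
- by apply: kP.
- have /(_ _ tk uk) := @cantor_real_lt u t k; rewrite tu ltxx => h.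
  by have : false by apply: h => i /eqb [].
- have /(_ _ uk tk) := @cantor_real_lt t u k; rewrite tu ltxx => h.
  by have : false by apply: h => i /eqb [].
- by apply: kP.
Qed.

(** A bounded sequence is determined by the rationals below the real and imaginary
    parts of its terms. *)
Lemma linf_card (E : set (linf R)) : E #<= [set: set nat].
Proof.
pose code (x : linf R) : set nat := [set m | exists n b q,
  m = choice.pickle (n : nat, b : bool, q : rat) /\
  ratr q < (if b then complex.Re (x n) else complex.Im (x n))].
apply: (@card_le_inj _ _ _ _ code) => // x y _ _ xy.
have key b n : (if b then complex.Re (x n) else complex.Im (x n)) =
               (if b then complex.Re (y n) else complex.Im (y n)).
  have sub (z w : linf R) : code z = code w ->
     (if b then complex.Re (z n) else complex.Im (z n)) <=
     (if b then complex.Re (w n) else complex.Im (w n)).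
    move=> zw; rewrite leNgt; apply/negP => /rat_in_itvoo[q].
    rewrite in_itv /= => /andP[yq qx].
    have : code z (choice.pickle (n, b, q)) by exists n, b, q.
    rewrite zw => -[n' [b' [q' [/(pcan_inj choice.pickleK)[<- <- <-] q'y]]]].
    by move: (lt_trans yq q'y); rewrite ltxx.
  by apply/eqP; rewrite eq_le; apply/andP; split; apply: sub.
apply: linf_eq => n; have := key true n; have := key false n.
by case: (x n) (y n) => a b [c d] /= -> ->.
Qed.

End CantorReal.

(** * Algebras spanned by chains of idempotents *)

Section ChainAlgebra.
Context {R : realType}.
Local Notation C := R[i].
Local Notation linf := (linf R).
Implicit Types (x y z : linf) (D : set R).

Definition rat_cut (r : R) : linf := indicator (fun m => (ratr (decode (0 : rat) m) < r)%R).

Lemma rat_cutE r m : rat_cut r m = (ratr (decode (0 : rat) m) < r)%R%:R.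
Proof. by []. Qed.

Lemma rat_cutM r s : rat_cut r * rat_cut s = rat_cut (Num.min r s).
Proof. by apply: linf_eq => m; rewrite linfM !rat_cutE lt_min -natrM mulnb. Qed.

Lemma rat_cut_selfadjoint r : selfadjoint (rat_cut r).
Proof.
by apply/selfadjointP => m; exists (ratr (decode (0 : rat) m) < r)%R%:R; rewrite rat_cutE rmorph_nat.
Qed.

(** At the infinitely many indices of a rational between l and h the combination has
    the constant value of the right-hand sum, which therefore vanishes for a null
    sequence. *)
Lemma rat_cut_tail (s : seq R) (a : R -> C) (l h : R) : l < h ->
  (forall r, r \in s -> r <= l \/ h <= r) -> c0 R (\sum_(r <- s) a r *: rat_cut r) ->
  \sum_(r <- s | h <= r) a r = 0.
Proof.
move=> lh gap /c0P c0x; set b := \sum_(r <- s | h <= r) a r.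
apply: eq0_normc; apply: contrapT => /eqP bn.
have e0 : 0 < normc b by rewrite lt_def bn normc_ge0.
have [|N Nx] := c0x (normc b / 2); first by rewrite divr_gt0.
have [q] := rat_in_itvoo lh; rewrite in_itv /= => /andP[lq qh].
have [m Nm mq] := decode_often (0 : rat) q N.
have := Nx _ Nm; suff -> : (\sum_(r <- s) a r *: rat_cut r) m = b by lra.
rewrite linf_sum /b [RHS]big_mkcond !big_seq; apply: eq_bigr => r rs.
rewrite linfZ rat_cutE mq; have [rl|hr] := gap _ rs.
  rewrite ltNge (le_trans rl (ltW lq)) mulr0; case: leP => // hr.
  by have := le_trans hr rl; rewrite leNgt lh.
by rewrite (lt_le_trans qh hr) hr mulr1.
Qed.

(** The coefficient of r is the difference of the values of the combination just
    below and just above r. *)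
Lemma rat_cut_indep_c0 (s : seq R) (a : R -> C) : uniq s ->
  c0 R (\sum_(r <- s) a r *: rat_cut r) -> forall r, r \in s -> a r = 0.
Proof.
move=> us sc r rs.
have [l lr lP] : exists2 l, l < r & forall r', r' \in s -> r' <= l \/ r <= r'.
  elim: s {us sc rs} => [|x s [l lr lP]]; first by exists (r - 1) => //; lra.
  have [xr|rx] := ltP x r.
    exists (Num.max l x); first by rewrite gt_max lr.
    move=> y; rewrite inE le_max => /predU1P[->|/lP[yl|ry]]; first by left; rewrite lexx orbT.
      by left; rewrite yl.
    by right.
  by exists l => // y; rewrite inE => /predU1P[->|/lP//]; right.
have [h rh hP] : exists2 h, r < h & forall r', r' \in s -> r' <= r \/ h <= r'.
  elim: s {us sc rs lP} => [|x s [h rh hP]]; first by exists (r + 1) => //; lra.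
  have [rx|xr] := ltP r x.
    exists (Num.min h x); first by rewrite lt_min rh.
    move=> y; rewrite inE ge_min => /predU1P[->|/hP[yl|ry]]; first by right; rewrite lexx orbT.
      by left.
    by right; rewrite ry.
  by exists h => // y; rewrite inE => /predU1P[->|/hP//]; left.
have t1 := rat_cut_tail lr lP sc; have t2 := rat_cut_tail rh hP sc.
move: t1; rewrite big_mkcond (bigD1_seq r) //= lexx -big_mkcondr /=.
rewrite (_ : \sum_(i <- s | _) _ = 0) ?addr0//.
rewrite -[RHS]t2 big_seq_cond [RHS]big_seq_cond; apply: eq_bigl => y.
case ys: (y \in s) => //=; have [yr|hy] := hP _ ys.
  rewrite (leNgt h) (le_lt_trans yr rh) /=; apply/negP => /andP[yr' ry].
  by move/eqP: yr'; apply; apply/le_anti; rewrite yr.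
by rewrite hy (le_trans (ltW rh) hy) andbT; apply: contraTneq (lt_le_trans rh hy) => ->; rewrite ltxx.
Qed.

Lemma c0_0 : c0 R 0.
Proof. by apply/c0P => e e0; exists 0%N => n _; rewrite linf0 normc0 ltW. Qed.

Lemma rat_cut_linspan_mem D r : linspan (rat_cut @` D) (rat_cut r) -> D r.
Proof.
move=> /linspan_seqP[s [a [us sD rE]]]; apply: contrapT => nDr.
have [s' s'D sE] := seq_image sD.
have rs' : r \notin s' by apply/negP => /s'D.
have us' : uniq s' by move: us; rewrite sE => /map_uniq.
pose b t : C := if t == r then -1 else a (rat_cut t).
suff /eqP : b r = 0 by rewrite /b eqxx oppr_eq0 oner_eq0.
apply: (@rat_cut_indep_c0 (r :: s') b) (mem_head _ _); first by rewrite /= rs'.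
have -> : \sum_(t <- r :: s') b t *: rat_cut t = 0; last exact: c0_0.
rewrite big_cons {1}/b eqxx scaleN1r rE sE big_map -[RHS](addNr (\sum_(t <- s') a (rat_cut t) *: rat_cut t)).
congr (_ + _); apply: eq_big_seq => t ts; rewrite /b.
by case: eqP => // tr; move: rs'; rewrite -tr ts.
Qed.

Lemma rat_cut_inj : injective rat_cut.
Proof.
move=> r s rs; have : linspan (rat_cut @` [set s]) (rat_cut r).
  by rewrite rs; apply: sub_linspan; exists s.
by move/rat_cut_linspan_mem.
Qed.

(** A generating set S must involve every r in D, and each of its elements involves
    finitely many. *)
Lemma rat_cut_genalgebrable D : infinite_set D -> genalgebrable (linf_minus_c0 R) D D.
Proof.
move=> Dinf; pose G := rat_cut @` D; pose B := linspan G.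
have subalg D' : subalgebra (linspan (rat_cut @` D')).
  apply: linspan_subalgebra => _ _ [r Dr <-] [s Ds <-]; rewrite rat_cutM.
  by apply: sub_linspan; case: (leP r s) => _; [exists r|exists s].
have GB : algspan G = B.
  apply/seteqP; split; first by apply: algspan_min; [exact: subalg|exact: sub_linspan].
  apply: linspan_min; first exact/subalgebra_subspace/algspan_subalgebra.
  exact: sub_algspan.
exists B; split; first exact: subalg.
- move=> x /linspan_seqP[s [a [us sG xE]]].
  have [c0x|c0x] := pselect (c0 R x); last by left; left.
  right; have [r rD sE] := seq_image sG.
  have ur : uniq r by move: us; rewrite sE => /map_uniq.
  rewrite /= xE sE big_map big1_seq // => t /andP[_ tr].
  rewrite (@rat_cut_indep_c0 r (fun t => a (rat_cut t))) ?scale0r//.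
  by move: c0x; rewrite xE sE big_map.
- exists G; last by apply: inj_card_eq => r s _ _; exact: rat_cut_inj.
  split=> //; apply/lin_indepP => s a us sG s0 y.
  have [r rD sE] := seq_image sG.
  have ur : uniq r by move: us; rewrite sE => /map_uniq.
  rewrite sE => /mapP[t tr ->]; apply: (@rat_cut_indep_c0 r (fun t => a (rat_cut t))) => //.
  by move: s0; rewrite sE big_map => ->; exact: c0_0.
- split.
    exists G; last by apply: inj_card_eq => r s _ _; exact: rat_cut_inj.
    split=> //; first by have [r Dr] := infinite_setN0 Dinf; exists (rat_cut r), r.
      exact: sub_linspan.
    by move=> _ _ [r _ <-]; exact: rat_cut_selfadjoint.
  move=> S [_ SB _ Sgen].
  have ex x : exists F : seq R, S x -> linspan (rat_cut @` [set` F]) x.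
    have [Sx|] := pselect (S x); last by exists [::].
    have /linspan_seqP[s [a [us sG xE]]] := SB _ Sx.
    have [r rD sE] := seq_image sG; exists r => _; apply/linspan_seqP; exists s, a; split=> // y.
    by rewrite sE => /mapP[t tr ->]; exists t.
  have [F FP] := choice ex.
  have cover : D `<=` \bigcup_(x in S) [set` F x].
    move=> r Dr; apply: rat_cut_linspan_mem.
    have : B (rat_cut r) by apply: sub_linspan; exists r.
    rewrite -Sgen; apply: algspan_min; first exact: subalg.
    move=> x Sx; apply: linspan_mono (FP _ Sx) => _ [t tF <-].
    by exists t => //; exists x.
  apply: (@card_le_bigcup _ _ _ _ (fun x => [set` F x])) => // [Sfin|x _].
    apply: Dinf; apply: sub_finite_set cover _.
    by apply: bigcup_finite => // x _; exact: finite_seq.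
  exact/finite_set_countable/finite_seq.
Qed.

End ChainAlgebra.

(** * Algebras generated by coordinates *)

Section CoordinateAlgebras.
Context {R : realType}.
Local Notation C := R[i].
Local Notation linf := (linf R).
Local Notation coord := (@coord R).
Local Notation coordR := (@coordR R).
Implicit Types (x y z : linf) (S : set linf) (K L : set (set nat)).

(** Two indices that agree on all coordinates of L but not on t show that t cannot be
    approximated. *)
Lemma coord_closure_mem L t : closure (algspan (coord @` L)) (coord t) -> L t.
Proof.
move=> /closureP/(_ (4^-1))[|y /algspan_coord_sub[T TL Ty] ty]; first lra.
apply: contrapT => nLt; have tT : t \notin T by apply/negP => /TL.
have [m _ mP] := coord_hit (R := R) (t :: T) (fun=> (0, 0)%N) 0.
have [n _ nP] := coord_hit (R := R) (t :: T) (fun u => if u == t then (1, 1)%N else (0, 0)%N) 0.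
have ymn : y m = y n.
  apply: (algspan_coord_agree Ty) => u uT; rewrite mP ?nP ?inE ?uT ?orbT//.
  by case: eqP => // ut; rewrite -ut uT in tT.
have := normc_subD (y m) (coord t m) (coord t n).
have := ty m; have := ty n; rewrite ymn [normc (y n - _)]normc_subC.
have -> : normc (coord t m - coord t n) = 1.
  rewrite !coordE -rmorphB normc_real mP ?mem_head// nP ?mem_head// eqxx frac0.
  by rewrite /frac divr1 sub0r normrN normr1.
lra.
Qed.

(** An approximation of x by a polynomial in finitely many coordinates takes its value
    at n infinitely often, so that x nearly does. *)
Lemma closure_coord_c0 x : closure (algspan (range coord)) x ->
  (linf_minus_c0 R `|` [set 0]) x.
Proof.
move=> /closureP cx; have [->|x0] := eqVneq x 0; first by right.
have [n xn] : exists n, x n != 0.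
  apply: contrapT => nx; move/eqP: x0; apply; apply: linf_eq => n.
  by apply: contrapT => /eqP xn; apply: nx; exists n.
have e0 : 0 < normc (x n).
  by rewrite lt_def normc_ge0 andbT; apply: contra_neq xn => /eq0_normc.
have [|y /algspan_coord_sub[T _ Ty] xy] := cx (normc (x n) / 4); first lra.
apply: (@in_linf_minus_c0 _ _ (normc (x n) / 4)); first lra.
move=> N; pose v t := let c := decode (0%N, [::] : seq (seq bool * (nat * nat))) n in
  lookup c.2 (prefix_of c.1 t).
have [m Nm mP] := coord_hit (R := R) T v N; exists m => //.
have ymn : y m = y n by apply: (algspan_coord_agree Ty) => t tT; rewrite mP.
have := normc_subD (y n) (x n) 0; rewrite !subr0.
have := normc_subD (x m) (y m) 0; rewrite !subr0 ymn [normc (y n - _)]normc_subC -[in X in _ - X]ymn.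
have := xy n; have := xy m; rewrite ymn; lra.
Qed.

(** Otherwise S, with n elements, generates n + 1 distinct coordinates. *)
Lemma coord_gen_finite K S : S `<=` @selfadjoint R -> S `<=` closure (algspan (range coord)) ->
  finite_set S -> (forall t, K t -> closure (algspan S) (coord t)) -> K #<= S.
Proof.
move=> Ssa Scl /finite_seqP[s0 sE] KS.
pose s := undup s0; have us : uniq s by exact: undup_uniq.
have {}sE : S = [set` s] by apply/seteqP; rewrite sE; split=> z /=; rewrite mem_undup.
pose f : 'I_(size s) -> linf := tnth (in_tuple s).
have fS j : S (f j) by rewrite sE /=; apply: mem_tnth.
have rf : range f = S.
  apply/seteqP; split=> [_ [j _ <-]//|z]; rewrite sE /= => zs.
  have zi : (index z s < size s)%N by rewrite index_mem.
  by exists (Ordinal zi) => //; rewrite /f (tnth_nth z) /= nth_index.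
have no (t : nat -> set nat) : (forall i j, (i <= size s)%N -> (j <= size s)%N -> t i = t j -> i = j) ->
    (forall i, (i <= size s)%N -> K (t i)) -> False.
  move=> tinj tK; apply: (@coord_dimension R (size s) (fun i => t i) f) => [i j /tinj tij|j|j|i].
  - by apply: val_inj; apply: tij; rewrite -ltnS.
  - exact: Ssa.
  - exact: Scl.
  - by rewrite rf; apply/KS/tK; rewrite -ltnS.
have [/finite_seqP[r0 rE]|/infiniteP Kinf] := pselect (finite_set K); last first.
  have [u uK ui] := card_le_injP (ex_intro _ 0%N I) Kinf.
  by exfalso; apply: (no u) => [i j _ _|i _]; [apply: ui; rewrite in_setT|exact: uK].
pose r := undup r0; have ur : uniq r by exact: undup_uniq.
have {}rE : K = [set` r] by apply/seteqP; rewrite rE; split=> z /=; rewrite mem_undup.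
have [rs|sr] := leqP (size r) (size s); last first.
  exfalso; apply: (no (nth set0 r)) => [i j ir jr /eqP|i ir].
    by rewrite nth_uniq ?(leq_ltn_trans _ sr)// => /eqP.
  by rewrite rE /=; apply: mem_nth; apply: leq_ltn_trans ir sr.
apply: (@card_le_inj _ _ _ _ (fun t => nth 0 s (index t r))) => [t|t u].
  by rewrite rE sE /= => tr; apply: mem_nth; apply: leq_trans rs; rewrite index_mem.
rewrite rE !inE /= => tr ur' /eqP.
rewrite nth_uniq ?(leq_trans _ rs) ?index_mem// => /eqP tu.
by rewrite -(nth_index set0 tr) tu nth_index.
Qed.

(** Each x in S is a limit of a sequence of polynomials in coordinates, hence lies in the
    closed algebra of a countable set F x of coordinates. *)
Lemma coord_gen_infinite K S : infinite_set S -> S `<=` closure (algspan (coord @` K)) ->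
  (forall t, K t -> closure (algspan S) (coord t)) -> K #<= S.
Proof.
move=> Sinf SK KS.
have ex x : exists F : set (set nat), S x ->
    countable F /\ closure (algspan (coord @` F)) x.
  have [Sx|] := pselect (S x); last by exists set0.
  have exT (j : nat) : exists T : seq (set nat), exists2 y, algspan (coord @` [set` T]) y &
      forall n, normc (x n - y n) <= j.+1%:R^-1.
    have /closureP/(_ j.+1%:R^-1)[|y /algspan_coord_sub[T _ Ty] xy] := SK _ Sx.
      by rewrite invr_gt0 ltr0n.
    by exists T, y.
  have [T TP] := choice exT.
  exists (\bigcup_j [set` T j]) => _; split.
    by apply: bigcup_countable => // j _; exact/finite_set_countable/finite_seq.
  apply/closureP => e e0; pose j := Num.trunc e^-1.
  have [y Ty xy] := TP j; exists y.
    by apply: algspan_mono Ty => _ [t tT <-]; exists t => //; exists j.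
  move=> n; apply: le_trans (xy n) _; rewrite -[leRHS]invrK lef_pV2 ?posrE ?ltr0n ?invr_gt0//.
  exact/ltW/truncnS_gt.
have [F FP] := choice ex.
apply: (@card_le_bigcup _ _ _ _ F) => // [t Kt|x /FP[]//].
apply: coord_closure_mem.
set U := \bigcup_(s in S) F s.
have cU : subalgebra (closure (algspan (coord @` U))).
  exact/closure_subalgebra/algspan_subalgebra.
rewrite -closure_idem; apply: closureS (KS _ Kt); apply: algspan_min => //.
move=> x Sx; have [_] := FP _ Sx; apply: closureS; apply: algspan_mono => _ [u Fu <-].
by exists u => //; exists x.
Qed.

Lemma coord_image_selfadjoint K : coord @` K `<=` @selfadjoint R.
Proof. by move=> _ [t _ <-]; exact: coord_selfadjoint. Qed.

Lemma coord_image_range K : coord @` K `<=` range coord.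
Proof. by move=> _ [t _ <-]; exists t. Qed.

Lemma coord_image_card K : coord @` K #= K.
Proof. by apply: inj_card_eq => t u _ _; exact: coord_inj. Qed.

Lemma coord_inv t k : exists m, coordR t m = k.+1%:R^-1.
Proof.
have [m _ mP] := coord_hit (R := R) [:: t] (fun=> (1, k.+1)%N) 0.
by exists m; rewrite mP ?mem_head// /frac /= (minn_idPl _) // mul1r.
Qed.

Lemma inv_nat_inj (F : numFieldType) : injective (fun k : nat => k.+1%:R^-1 : F).
Proof. by move=> i j /invr_inj/eqP; rewrite eqr_nat eqSS => /eqP. Qed.

Lemma poly_inv_nat_eq0 (F : numFieldType) (p : {poly F}) :
  (forall k : nat, p.[k.+1%:R^-1] = 0) -> p = 0.
Proof.
move=> p0; apply: (@roots_geq_poly_eq0 _ _ [seq k.+1%:R^-1 | k <- iota 0 (size p)]).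
- by apply/allP => _ /mapP[k _ ->]; apply/eqP.
- by rewrite map_inj_uniq ?iota_uniq//; exact: inv_nat_inj.
- by rewrite size_map size_iota.
Qed.

Lemma countable_products S : countable S -> countable (products S).
Proof.
move=> Sc; have [[s0 Ss0]|/set0P/negP] := pselect (S !=set0); last first.
  rewrite negbK => /eqP S0; rewrite (_ : products S = set0) //.
  rewrite -subset0 => z [s [s0 sS] _]; case: s s0 sS => // y s _ sS.
  by have := sS y (mem_head _ _); rewrite S0.
have /pcard_surjP[g gS] := Sc.
apply: (@card_le_trans _ _ _ [set: seq nat]); last exact: countableP.
apply: (@card_le_surj _ _ _ _ (fun l => \prod_(k <- l) g k)) => _ [s [_ sS] ->].
have sg y : y \in s -> (g @` [set: nat]) y by move=> ys; apply: gS; apply: sS.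
by have [r _ ->] := seq_image sg; exists r => //; rewrite big_map.
Qed.

(** The dimension is at most countable because the products of generators are, and it is
    infinite because a coordinate takes infinitely many values. *)
Lemma coord_genalgebrable K : K !=set0 -> K #<= [set: nat] ->
  genalgebrable (linf_minus_c0 R) [set: nat] K.
Proof.
move=> [t0 Kt0] Kc; set G := coord @` K; pose B := algspan G.
have sB : subalgebra B by exact: algspan_subalgebra.
have Bstar : star_closed B by exact/algspan_star/coord_image_selfadjoint.
have BR : B `<=` algspan (range coord) by exact/algspan_mono/coord_image_range.
exists B; split=> //.
- by move=> x /BR/sub_closure/closure_coord_c0.
- have [||F [_ FG iF FB]] := @basis_extension _ _ set0 (products G).
  + by apply/lin_indepP => -[|y s] a _ sE _ z //; have := sE y (mem_head _ _).
  + by move=> z [].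
  exists F; first by split.
  apply: eq_card_nat.
    have : countable (products G).
      by apply: countable_products; apply: card_le_trans (card_eqW (coord_image_card K)) Kc.
    by apply: sub_countable; apply: subset_card_le.
  move=> [d Fd].
  have dB : has_dim B `I_d by exists F.
  have [s sP] := findim_finval sB dB (sub_algspan (ex_intro2 _ _ t0 Kt0 erefl)).
  pose vs : seq C := [seq k.+1%:R^-1 | k <- iota 0 (size s).+1].
  have : (size vs <= size s)%N.
    apply: uniq_leq_size.
      by rewrite map_inj_uniq ?iota_uniq//; exact: inv_nat_inj.
    move=> _ /mapP[k _ ->]; have [m mk] := coord_inv t0 k.
    by have := sP m; rewrite coordE mk fmorphV rmorph_nat.
  by rewrite size_map size_iota ltnn.
- split.
    exists G; last exact: coord_image_card.
    split=> //; first by exists (coord t0), t0.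
      exact: sub_algspan.
    by move=> _; exact: coord_image_selfadjoint.
  move=> S [_ SB Ssa Sgen].
  have KS t : K t -> closure (algspan S) (coord t).
    by move=> Kt; apply: sub_closure; rewrite Sgen; apply: sub_algspan; exists t.
  have [Sfin|Sinf] := pselect (finite_set S).
    apply: coord_gen_finite => //; first exact: Ssa.
    by move=> x /SB/BR/sub_closure.
  by apply: card_le_trans Kc _; apply/infiniteP.
Qed.

Lemma resolvent_den (a v : R) : 0 <= a <= 2^-1 -> 0 <= v <= 1 -> 2^-1 <= 1 - a * v.
Proof. by move=> /andP[? ?] /andP[? ?]; nra. Qed.

(** A choice of continuum many reals between 1/4 and 1/2: nonzero, so that they have
    inverses, and at most 1/2, so that the geometric series below converges
    uniformly. *)
Definition ratio t : R := (cantor_real R t + 1) / 4.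

Lemma ratio_itv t : 4^-1 <= ratio t <= 2^-1.
Proof. by have /andP[h1 h2] := cantor_real_itv R t; rewrite /ratio; apply/andP; split; lra. Qed.

Lemma ratio_inj : injective ratio.
Proof. by move=> t u; rewrite /ratio => h; apply: (@cantor_real_inj R); lra. Qed.

Definition resolventR (t a : set nat) m : R := coordR t m / (1 - ratio a * coordR t m).

Lemma resolvent_bounded t a : bounded_seq (fun m => (resolventR t a m)%:C).
Proof.
apply: (@bounded_seq_le _ _ 2) => m; rewrite normc_real /resolventR.
have ra := ratio_itv a; have va := coordR_itv (R := R) t m.
have den : 2^-1 <= 1 - ratio a * coordR t m by apply: resolvent_den => //; lra.
rewrite ger0_norm; first by rewrite ler_pdivrMr; lra.
by apply: divr_ge0; lra.
Qed.

Definition resolvent t a : linf := Linf (resolvent_bounded t a).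

(** The partial sums of the geometric series for x / (1 - r x), where x is the
    coordinate and r is ratio a, are polynomials in x without constant term. *)
Lemma resolvent_closure t a : closure (algspan [set coord t]) (resolvent t a).
Proof.
apply/closureP => e e0; pose n := Num.trunc (2 / e).
pose b : C := (ratio a)%:C.
exists (\sum_(k < n.+1) b ^+ k *: coord t ^+ k.+1).
  apply: subspace_sum => [|k _]; first exact/subalgebra_subspace/algspan_subalgebra.
  by have [_ _ sZ _] := algspan_subalgebra [set coord t]; apply/sZ/algspan_exp.
move=> m; have ra := ratio_itv a; have va := coordR_itv (R := R) t m.
have den : 2^-1 <= 1 - ratio a * coordR t m by apply: resolvent_den => //; lra.
set v := coordR t m in va den *; set r := ratio a in ra den *.
have -> : (\sum_(k < n.+1) b ^+ k *: coord t ^+ k.+1) m =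
    (v / (1 - r * v) - r ^+ n.+1 * v ^+ n.+2 / (1 - r * v))%:C.
  rewrite linf_sum; transitivity ((\sum_(k < n.+1) r ^+ k * v ^+ k.+1)%:C).
    rewrite rmorph_sum; apply: eq_bigr => k _; rewrite linfZ linfX.
    by rewrite coordE /b -!rmorphXn -rmorphM.
  congr (_%:C); elim: n.+1 => [|k IH].
    by rewrite big_ord0 expr0 mul1r expr1 subrr.
  rewrite big_ord_recr /= IH; rewrite !exprS; field.
  by rewrite gt_eqF //; lra.
rewrite -[resolvent t a m]/((v / (1 - r * v))%:C) -rmorphB normc_real.
rewrite opprB addrC subrK.
have r0 : 0 <= r by lra.
have v0 : 0 <= v by lra.
rewrite ger0_norm; last first.
  by apply: divr_ge0; [rewrite mulr_ge0 ?exprn_ge0|lra].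
rewrite ler_pdivrMr; last by lra.
have h1 : r ^+ n.+1 * v ^+ n.+2 <= (2^-1) ^+ n.+1 * 1.
  apply: ler_pM; rewrite ?exprn_ge0//; first by rewrite lerXn2r ?nnegrE//; lra.
  by rewrite exprn_ile1 //; lra.
apply: le_trans h1 _; rewrite mulr1.
have h2 : (2^-1) ^+ n.+1 <= e / 2.
  rewrite exprVn -[leRHS]invrK lef_pV2 ?posrE ?invr_gt0 ?divr_gt0 ?exprn_gt0//.
  rewrite invf_div; apply: le_trans (ltW (truncnS_gt _)) _.
  by rewrite -/n -natrX ler_nat ltnW // ltn_expl.
by apply: le_trans h2 _; rewrite ler_pM2l//.
Qed.

(** Clearing denominators turns a linear relation into a polynomial Q that vanishes at
    the infinitely many values of the coordinate; evaluating Q = 0 at the pole 1 / a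
    isolates the coefficient of a (where a stands for its ratio). *)
Lemma resolvent_indep t (s : seq (set nat)) (c : set nat -> C) : uniq s ->
  \sum_(a <- s) c a *: resolvent t a = 0 -> forall a, a \in s -> c a = 0.
Proof.
move=> us s0 a as_.
pose l (a : set nat) : {poly C} := 1 - (ratio a)%:C *: 'X.
have lE a' v : (l a').[v] = 1 - (ratio a')%:C * v by rewrite /l !hornerE.
pose Q := \sum_(b <- s) c b *: \prod_(d <- s | d != b) l d.
have Q0 : Q = 0.
  apply: poly_inv_nat_eq0 => k; have [m mk] := coord_inv t k.
  have -> : k.+1%:R^-1 = (coordR t m)%:C :> C by rewrite mk fmorphV rmorph_nat.
  have v0 : (coordR t m)%:C != 0 :> C by rewrite mk fmorph_eq0 invr_eq0 pnatr_eq0.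
  have den b : (l b).[(coordR t m)%:C] != 0.
    rewrite lE -rmorphM -(rmorph1 (real_complex R)) -rmorphB fmorph_eq0 gt_eqF//.
    have := ratio_itv b; have := coordR_itv (R := R) t m => h1 h2.
    have : 2^-1 <= 1 - ratio b * coordR t m by apply: resolvent_den => //; lra.
    lra.
  apply: (mulfI v0); rewrite mulr0 /Q horner_sum mulr_sumr.
  transitivity ((\prod_(d <- s) (l d).[(coordR t m)%:C]) * (\sum_(a <- s) c a *: resolvent t a) m).
    rewrite linf_sum mulr_sumr; apply: eq_big_seq => b bs.
    rewrite hornerZ horner_prod linfZ.
    have -> : \prod_(d <- s) (l d).[(coordR t m)%:C] = (l b).[(coordR t m)%:C] *
        \prod_(d <- s | d != b) (l d).[(coordR t m)%:C] by rewrite (bigD1_seq b).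
    have -> : resolvent t b m = (coordR t m)%:C / (l b).[(coordR t m)%:C].
      by rewrite lE -rmorphM -(rmorph1 (real_complex R)) -rmorphB -fmorphV -rmorphM.
    by field; exact: den.
  by rewrite s0 linf0 mulr0.
have ra0 : ratio a != 0 by rewrite gt_eqF //; have := ratio_itv a; lra.
have /eqP := congr1 (fun p : {poly C} => p.[(ratio a)^-1%:C]) Q0.
have lb b : ((l b).[(ratio a)^-1%:C] == 0) = (b == a).
  rewrite lE -rmorphM -(rmorph1 (real_complex R)) -rmorphB fmorph_eq0 subr_eq0.
  rewrite -(inj_eq (mulIf ra0)) mul1r divfK // eq_sym.
  by rewrite (inj_eq ratio_inj).
rewrite horner0 /Q horner_sum (bigD1_seq a) // [\sum_(b <- s | b != a) _]big1_seq ?Monoid.mulm1; last first.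
  move=> b /andP[ba bs]; rewrite hornerZ horner_prod.
  apply/eqP; rewrite mulf_eq0 prodf_seq_eq0; apply/orP; right.
  by apply/hasP; exists a => //; rewrite eq_sym ba lb eqxx.
rewrite hornerZ horner_prod mulf_eq0 => /orP[/eqP//|].
by rewrite prodf_seq_eq0 => /hasP[d _]; rewrite lb => /andP[/negPf ->].
Qed.

End CoordinateAlgebras.

(** * The theorem *)

Section Assembly.
Context {R : realType}.
Local Notation linf := (linf R).
Local Notation coord := (@coord R).

Lemma resolvent_inj t : injective (@resolvent R t).
Proof.
move=> a b ab; apply: contrapT => /eqP ne.
pose c d : R[i] := if d == a then 1 else -1.
suff /eqP : c a = 0 by rewrite /c eqxx oner_eq0.
apply: (@resolvent_indep R t [:: a; b] c) (mem_head _ _); first by rewrite /= inE ne.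
by rewrite big_cons big_seq1 /c eqxx eq_sym (negPf ne) ab scale1r scaleN1r subrr.
Qed.

Lemma coord_cstar_genalgebrable (K : set (set nat)) : K !=set0 ->
  cstar_genalgebrable (linf_minus_c0 R) [set: set nat] K.
Proof.
move=> [t0 Kt0]; set G := coord @` K; pose B := closure (algspan G).
have sB : subalgebra B by exact/closure_subalgebra/algspan_subalgebra.
have BR : B `<=` closure (algspan (range coord)).
  exact/closureS/algspan_mono/coord_image_range.
exists B; split.
- split=> //; last exact: closed_closure.
  exact/closure_star/algspan_star/coord_image_selfadjoint.
- by move=> x /BR/closure_coord_c0.
- have [||F [EF FB iF BF]] := @basis_extension _ _ (range (@resolvent R t0)) B.
  + apply/lin_indepP => s a us sE s0 y; have [r _ sr] := seq_image sE.
    have ur : uniq r by move: us; rewrite sr => /map_uniq.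
    rewrite sr => /mapP[d dr ->].
    apply: (@resolvent_indep R t0 r (fun d => a (resolvent t0 d))) => //.
    by move: s0; rewrite sr big_map.
  + move=> _ [a _ <-]; apply: closureS (@resolvent_closure R t0 a).
    by apply: algspan_mono => _ ->; exists t0.
  exists F; first by split=> //; rewrite BF linspan_id //; exact: subalgebra_subspace.
  apply: Cantor_Bernstein; first exact: linf_card.
  apply: card_le_trans (subset_card_le EF); apply/card_eqWr/inj_card_eq.
  by move=> a b _ _; exact: resolvent_inj.
- split.
    exists G; last exact: coord_image_card.
    split=> //; first by exists (coord t0), t0.
    move=> x Gx; split; first exact/sub_closure/sub_algspan.
    exact: coord_image_selfadjoint Gx.
  move=> S [_ SB Sgen].
  have KS t : K t -> closure (algspan S) (coord t).
    by move=> Kt; rewrite Sgen; apply/sub_closure/sub_algspan; exists t.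
  have [Sfin|Sinf] := pselect (finite_set S).
    by apply: coord_gen_finite => // x /SB[] // /BR.
  by apply: coord_gen_infinite => // x /SB[].
Qed.

Lemma least_card_eq (T U V : Type) (P : set (set T)) (K : set U) (L : set V) :
  K #= L -> least_card P K -> least_card P L.
Proof.
move=> KL [[S PS SK] H]; split; first by exists S => //; apply: card_eq_trans SK KL.
by move=> S' PS'; apply: card_le_trans (card_eqWr KL) (H _ PS').
Qed.

Lemma has_dim_eq (T U : Type) (B : set linf) (D : set T) (E : set U) :
  D #= E -> has_dim B D -> has_dim B E.
Proof. by move=> DE [F FB FD]; exists F => //; apply: card_eq_trans FD DE. Qed.

End Assembly.

Lemma card_image_of (T U : Type) (K : set T) (L : set U) : K !=set0 -> K #<= L ->
  exists2 K' : set U, K' !=set0 & K' #= K.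
Proof.
move=> K0 /(card_le_injP K0)[f _ fi]; exists (f @` K); last exact: inj_card_eq.
by have [k Kk] := K0; exists (f k), k.
Qed.

Lemma card_nat_sets : [set: nat] #<= [set: set nat].
Proof.
apply: (@card_le_inj _ _ _ _ (fun n => [set n])) => // i j _ _ ij.
by have : [set j] i by rewrite -ij.
Qed.

Lemma card_ge1_neq0 (T : Type) (K : set T) : `I_1 #<= K -> K !=set0.
Proof.
have I0 : `I_1 !=set0 by exists 0%N.
by move=> /(card_le_injP I0)[f fK _]; exists (f 0%N); apply: fK.
Qed.

Theorem theorem3p19 (R : realType) :
  let M := linf_minus_c0 R in
  let continuum := [set: set nat] in
  let aleph0 := [set: nat] in
  [/\ (forall d : nat, (0 < d)%N ->
         genalgebrable M `I_d `I_1 /\ cstar_genalgebrable M `I_d `I_1),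
      (forall d n : nat, n <> 1%N ->
         ~ genalgebrable M `I_d `I_n /\ ~ cstar_genalgebrable M `I_d `I_n),
      (forall (T : Type) (K : set T), `I_1 #<= K -> K #<= continuum ->
         cstar_genalgebrable M continuum K),
      (forall (T : Type) (K : set T), `I_1 #<= K -> K #<= aleph0 ->
         genalgebrable M aleph0 K) &
      (forall (T : Type) (K : set T),
         aleph0 #<= K -> aleph0 #!= K -> K #<= continuum ->
         genalgebrable M K K)].
Proof.
move=> M continuum aleph0; split.
- exact: periodic_genalgebrable.
- by move=> d n; exact: findim_not_genalgebrable.
- move=> T K /card_ge1_neq0 K0 /(card_image_of K0)[L L0 LK].
  have [B [csB BM dimB gB]] := coord_cstar_genalgebrable (R := R) L0.
  by exists B; split=> //; apply: least_card_eq LK gB.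
- move=> T K /card_ge1_neq0 K0 Kc.
  have [L L0 LK] := card_image_of K0 (card_le_trans Kc card_nat_sets).
  have Lc : L #<= aleph0 by apply: card_le_trans (card_eqW LK) Kc.
  have [B [sB BM dimB gB]] := coord_genalgebrable (R := R) L0 Lc.
  by exists B; split=> //; apply: least_card_eq LK gB.
- move=> T K Kinf _ Kc; have K0 : K !=set0 by apply/infinite_setN0/infiniteP.
  have [L L0 LK] := card_image_of K0 Kc.
  have DK : cantor_real R @` L #= K.
    by apply: card_eq_trans LK; apply: inj_card_eq => t u _ _; exact: cantor_real_inj.
  have Dinf : infinite_set (cantor_real R @` L).
    by apply/infiniteP; apply: card_le_trans Kinf (card_eqWr DK).
  have [B [sB BM dimB gB]] := rat_cut_genalgebrable Dinf.
  by exists B; split=> //; [apply: has_dim_eq DK dimB|apply: least_card_eq DK gB].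
Qed.
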